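(* Let $\alpha$ be an irreducible, ergodic and nonexpansive automorphism of a compact connected abelian group $X$, and let $Y$ be a mixing shift of finite type with finite or countably infinite alphabet. Then every continuous equivariant map $\phi:Y\to X$ sends $Y$ to a single point.
   Context: A continuous automorphism $\alpha$ of a compact abelian group $X$ is irreducible if every closed $\alpha$-invariant subgroup of $X$ other than $X$ itself is finite. Ergodicity is with respect to Haar measure; nonexpansive means not expansive. Let $A$ be a finite or countably infinite set and $P=(P(a,a'))_{a,a'\in A}$ a transition matrix with entries in $\{0,1\}$. The associated shift of finite type is $X_P=\{x=(x_n)\in A^{\mathbb{Z}}:P(x_n,x_{n+1})=1\text{ for every }n\in\mathbb{Z}\}$, with the topology induced by the product of discrete topologies and the shift $T$, $(Tx)_n=x_{n+1}$. It is irreducible if for every $a,a'\in A$ there exist $n\ge1$ and elements $a_0=a,a_1,\dots,a_n=a'$ in $A$ with $P(a_i,a_{i+1})=1$ for $i=0,\dots,n-1$. If $X_P$ is irreducible, its period is the highest common factor of the set of integers $n\ge1$ for which there exist $a_0,a_1,\dots,a_n=a_0$ in $A$ with $P(a_i,a_{i+1})=1$ for $i=0,\dots,n-1$. $X_P$ is mixing if it is irreducible with period $1$. A map $\phi:Y\to X$ is equivariant if $\phi\circ T=\alpha\circ\phi$. *)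

(* Defs.v *)
From HB Require Import structures.
From mathcomp Require Import all_boot all_order all_algebra.
From mathcomp Require Import all_classical all_reals all_analysis.

Set Implicit Arguments.
Unset Strict Implicit.
Unset Printing Implicit Defensive.

Import Order.TTheory GRing.Theory Num.Theory.

Local Open Scope classical_set_scope.
Local Open Scope ring_scope.

Record topAut (X : topologicalZmodType) := TopAut {
  aut_fun :> {additive X -> X};
  aut_inv : X -> X;
  aut_funK : cancel aut_fun aut_inv;
  aut_invK : cancel aut_inv aut_fun;
  aut_fun_continuous : continuous aut_fun;
  aut_inv_continuous : continuous aut_inv }.

Definition aut_iter (X : topologicalZmodType) (alpha : topAut X) (n : int)
    : X -> X :=
  match n with
  | Posz k => iter k alpha
  | Negz k => iter k.+1 (aut_inv alpha)
  end.

Definition subgroup_set (X : zmodType) (H : set X) : Prop :=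
  H 0 /\ (forall x y, H x -> H y -> H (x - y)).

(* Invariance of a subgroup means alpha(H) = H, not merely alpha(H) `<=` H. *)
Definition irreducible_aut (X : topologicalZmodType) (alpha : topAut X)
    : Prop :=
  forall H : set X, closed H -> subgroup_set H -> alpha @` H = H ->
    H <> [set: X] -> finite_set H.

(* Expansiveness for the uniform structure of the group: no nonzero point has
   its whole two-sided orbit inside a suitable neighbourhood of 0. *)
Definition expansive (X : topologicalZmodType) (alpha : topAut X) : Prop :=
  exists2 U : set X, nbhs 0 U &
    [set x | forall n : int, U (aut_iter alpha n x)] = [set 0].

(* The explicit carrier lets the pointed structure required by the measurable
   types be found through the zmodType underlying X. *)
Definition borel (X : topologicalZmodType) :=
  @g_sigma_algebraType (GRing.Zmodule.sort X) (@open X).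

(* On a compact Hausdorff group, outer regularity of a Borel probability
   measure gives inner regularity by complementation, so this is the usual
   characterization of normalized Haar measure. *)
Definition is_haar (R : realType) (X : topologicalZmodType)
    (mu : probability (borel X) R) : Prop :=
  (forall (x : X) (B : set (borel X)), measurable B ->
     mu [set x + b | b in (B : set X)] = mu B) /\
  (forall B : set (borel X), measurable B ->
     mu B = ereal_inf
       [set mu U | U in [set U : set X | open U /\ B `<=` U]]).

(* Invariance of mu under the map is not demanded: it is automatic for Haar
   measure and a surjective continuous endomorphism. *)
Definition ergodic (R : realType) (X : topologicalZmodType)
    (mu : probability (borel X) R) (alpha : topAut X) : Prop :=
  forall B : set (borel X), measurable B -> alpha @^-1` B = B ->
    mu B = 0%E \/ mu B = 1%E.

Definition bisequences (A : countType) :=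
  prod_topology (fun _ : int => discrete_topology A).

Definition shift_seq (A : countType) (x : bisequences A) : bisequences A :=
  fun n => x (n + 1).

Definition sft (A : countType) (P : rel A) : set (bisequences A) :=
  [set x | forall n : int, P (x n) (x (n + 1))].

Definition walk (A : countType) (P : rel A) (n : nat) (a a' : A) : Prop :=
  exists p : seq A, [/\ size p = n, path P a p & last a p = a'].

Definition irreducible_sft (A : countType) (P : rel A) : Prop :=
  forall a a' : A, exists n : nat, (1 <= n)%N /\ walk P n a a'.

Definition return_length (A : countType) (P : rel A) : set nat :=
  [set n | (1 <= n)%N /\ exists a : A, walk P n a a].

(* For an empty alphabet the highest common factor is 0, so the empty shift is
   not mixing. *)
Definition is_hcf (S : set nat) (d : nat) : Prop :=
  (forall n, S n -> (d %| n)%N) /\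
  (forall e, (forall n, S n -> (e %| n)%N) -> (e %| d)%N).

Definition mixing_sft (A : countType) (P : rel A) : Prop :=
  irreducible_sft P /\ is_hcf (return_length P) 1.

(* Main.v *)
Require Import Defs.
From HB Require Import structures.
From mathcomp Require Import all_boot all_order all_algebra.
From mathcomp Require Import all_classical all_reals all_analysis.
From mathcomp Require Import measurable_realfun.
From mathcomp Require Import complex ring lra zify.

(** The theorem reduces to one statement about the group: an irreducible
    nonexpansive automorphism [alpha] has no homoclinic point other than 0
    ([no_homoclinic]), a point [z] being homoclinic when [alpha^n z] tends to 0
    as [n] tends to both infinities.  Fix a periodic point [p] of the shift.
    Because the shift is mixing, the points that agree with [p], in the same
    phase, off a finite window are dense; for such a point [w] the difference
    [phi w - phi p] is homoclinic.  This uses continuity of [phi] at the finitely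
    many points of the orbit of [p] only, so a countable alphabet does no harm.
    Hence [phi] is constant on a dense set.

    For the statement about the group a single nonconstant character
    [X -> R/Z] is enough, since the points killed by its whole orbit form a
    proper closed invariant subgroup, which is finite by irreducibility.

    The character comes from an extremal problem for the Haar integral.  Take a
    continuous positive definite kernel, subtract its mean to get [h], and among
    the positive definite [p] with [p 0 = 1] maximize [F p], the integral of the
    product of [h] and [p], with value [r].  Since [2 p] plus or minus
    [p (. + y) + p (. - y)] is again positive definite, the correlation of [h] with
    a near-maximizer [p] equals [r p] up to a small uniform error; this makes
    maximizing sequences asymptotically equicontinuous and the maximum attained.
    Among the maximizers one that also maximizes the integral of [p^2], a strictly
    convex functional, is extreme, and extremality is d'Alembert's equation
    [p (x + y) + p (x - y) = 2 p x p y].  Thus [p] is the real part of a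
    character, nontrivial because [F 1 = 0 < r] ([exists_cosine],
    [cosine_character]).

    Next, some nonzero integer polynomial in [alpha] vanishes on [X]
    ([annihilator]).  By irreducibility and connectedness a polynomial in [alpha]
    is zero or onto on [X].  If every nonzero polynomial were onto, the characters
    [chi o alpha^k] of a nontrivial [chi] would be independent, so by Kronecker's theorem some [x] would have [chi (alpha^n x)]
    equal to any prescribed constant for all [n]; the points whose orbit under
    [chi] is constant would be an infinite proper closed invariant subgroup.

    Let [f] be an annihilator of minimal degree, and lift [chi (alpha^n x)] to real
    angles [a_n] of absolute value at most [pi].  Then the recurrence [f] applied to
    [a] takes values in [2 pi Z].
    - If [f] has no root of modulus 1 and the orbit of [x] stays close to 0, these
      values are 0, and the bounded sequence [a] vanishes; so [alpha] is expansive
      ([expansive_of_no_unit_root]).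
    - If [f] has a root [w] of modulus 1, its minimal polynomial [g] also
      annihilates.  For homoclinic [z] the sequence [g a / 2 pi] is integral and
      finitely supported; as [a_n] tends to 0, telescoping along the root [w]
      shows that its generating polynomial vanishes at [w].  So it is divisible by
      [g] up to a constant [k], hence [k a / 2 pi] is integral, and [k z] lies in
      the finite subgroup above.  A homoclinic point in a finite invariant set is
      0, and [z = 0] follows ([homoclinic_eq0_of_unit_root]). *)

Set Implicit Arguments.
Unset Strict Implicit.
Unset Printing Implicit Defensive.

Import Order.TTheory GRing.Theory Num.Theory.
Import numFieldNormedType.Exports.

Local Open Scope classical_set_scope.
Local Open Scope ring_scope.

(** * Continuous functions on a compact abelian group *)

Lemma cont_comp (T U V : topologicalType) (f : T -> U) (g : U -> V) :
  continuous f -> continuous g -> continuous (fun x => g (f x)).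
Proof. by move=> cf cg x; exact: (cvg_comp _ _ (cf x) (cg (f x))). Qed.

Section Continuity.
Variables (R : realType) (X : topologicalZmodType).
Implicit Types (f g : X -> R).

Lemma cont_add f g : continuous f -> continuous g -> continuous (fun x => f x + g x).
Proof. by move=> cf cg x; apply: cvgD; [exact: cf|exact: cg]. Qed.

Lemma cont_opp f : continuous f -> continuous (fun x => - f x).
Proof. by move=> cf x; apply: cvgN; exact: cf. Qed.

Lemma cont_mul f g : continuous f -> continuous g -> continuous (fun x => f x * g x).
Proof. by move=> cf cg x; apply: cvgM; [exact: cf|exact: cg]. Qed.

Lemma cont_const (a : R) : continuous (fun _ : X => a).
Proof. by move=> x; exact: cvg_cst. Qed.

Lemma cvg_add_group (T : Type) (F : set_system T) (FF : Filter F) (a b : T -> X) (x y : X) :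
  a @ F --> x -> b @ F --> y -> (fun t => a t + b t) @ F --> x + y.
Proof.
move=> ax by_; apply: (@cvg_comp _ _ _ (fun t => (a t, b t)) (fun z => z.1 + z.2) _
    (nbhs (x, y))); last exact: (@add_continuous X (_, _)).
exact: cvg_pair.
Qed.

Lemma cont_shiftr (T : topologicalType) (f : X -> T) y :
  continuous f -> continuous (fun x => f (x + y)).
Proof.
move=> cf x; apply: (@continuous_comp _ _ _ (fun x => x + y) f); last exact: cf.
by apply: cvg_add_group; [exact: cvg_id|exact: cvg_cst].
Qed.

Lemma cont_shiftl (T : topologicalType) (f : X -> T) y :
  continuous f -> continuous (fun x => f (y + x)).
Proof. by move=> /cont_shiftr cf; under eq_fun do rewrite addrC; exact: cf. Qed.

(** Neighbourhoods of 0 transport to every point, so that a single neighbourhood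
    of 0 can serve as a modulus of uniform continuity. *)
Lemma nbhs_shift (x : X) (U : set X) : nbhs 0 U -> nbhs x [set y | U (y - x)].
Proof. by have := @cont_shiftr X id (- x) _ x; rewrite /continuous_at subrr; apply. Qed.

Hypothesis compX : compact [set: X].

Lemma cont_uniform f (e : R) : continuous f -> 0 < e ->
  \forall u \near (0 : X), forall x, `|f (x + u) - f x| < e.
Proof.
move=> cf e0.
have /compact_near_coveringP/(_ X (nbhs (0 : X))
  (fun u x => `|f (x + u) - f x| < e)) := compX.
have cov : forall x, [set: X] x ->
    \forall x' \near x & u \near (0 : X), `|f (x' + u) - f x'| < e.
  move=> x _.
  have h : (fun z : X * X => f (z.1 + z.2) - f z.1) @ (x, 0 : X) --> (0 : R).
    rewrite -[X in _ --> X](subrr (f x)); apply: cvgB.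
      have := @add_continuous X (x, 0); rewrite /continuous_at /= addr0 => ax.
      exact: (cvg_comp _ _ ax (cf x)).
    exact: (cvg_comp _ _ (@cvg_fst _ _ (nbhs x) (nbhs (0 : X)) _) (cf x)).
  by have /cvgrPdist_lt/(_ e e0) := h; apply: filterS => z /=; rewrite sub0r normrN.
move=> /(_ _ cov); apply: filterS => u Pu x; exact: Pu.
Qed.

Lemma cont_bounded f : continuous f -> exists2 M, 0 < M & forall x, `|f x| <= M.
Proof.
move=> cf; have /compact_bounded[M [_ mrt]] :
    compact [set f x | x in [set: X]].
  by apply: continuous_compact => //; exact: continuous_subspaceT.
exists (`|M| + 1); first by rewrite ltr_wpDl.
move=> x; apply: (mrt (`|M| + 1)); last by exists x.
by rewrite ltr_pwDr // ler_norm.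
Qed.

(** The filter on finite sequences ordered by inclusion turns the near-covering
    form of compactness into a finite net. *)
Lemma finite_cover (U : set X) : nbhs 0 U ->
  exists s : seq X, forall x, exists2 y, y \in s & U (x - y).
Proof.
move=> U0; pose F : set_system (seq X) :=
  filter_from [set: seq X] (fun s => [set s' : seq X | {subset s <= s'}]).
have FF : Filter F.
  apply: filter_from_filter; first by exists [::].
  move=> s1 s2 _ _; exists (s1 ++ s2) => // s' ss.
  by split=> x xs; apply: ss; rewrite mem_cat xs ?orbT.
have /compact_near_coveringP/(_ _ F
  (fun s x => exists2 y, y \in s & U (x - y)) FF) := compX.
case=> [x _|s _ sP].
  exists ([set x' | U (x' - x)], [set s' : seq X | x \in s']); last first.
    by move=> [x' s'] [/= Ux xs]; exists x.
  split=> /=; last by exists [:: x] => // s' ss; apply: ss; rewrite inE.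
  exact: nbhs_shift.
by exists s => x; apply: (sP s).
Qed.

End Continuity.

Lemma cont_mulrz (X : topologicalZmodType) (T : topologicalType) (f : T -> X) (n : int) :
  continuous f -> continuous (fun x => f x *~ n).
Proof.
move=> cf.
have nat_case k : continuous (fun x => f x *+ k).
  elim: k => [|k IH] x; first by apply: cvg_cst.
  rewrite /continuous_at mulrS; under eq_fun do rewrite mulrS.
  by apply: cvg_add_group; [exact: cf|exact: IH].
case: n => k; first exact: nat_case.
move=> x; rewrite /continuous_at NegzE mulrNz; under eq_fun do rewrite mulrNz.
exact: (cvg_comp _ _ (nat_case k.+1 x) (@opp_continuous X _)).
Qed.

(** Matching on the head operation keeps the higher-order unification of the
    translation lemmas last. *)
Ltac cont := repeat (cbv beta; first [assumption | exact: cont_const | apply: cont_add | apply: cont_mul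
  | apply: cont_opp | apply: cont_shiftr | apply: cont_shiftl]).

(** * Iterates of the automorphism *)

Lemma int_ind_succ_pred (Q : int -> Prop) : Q 0 -> (forall n, Q n -> Q (n + 1)) ->
  (forall n, Q n -> Q (n - 1)) -> forall n, Q n.
Proof.
move=> Q0 QS QP; case=> k.
  elim: k => // k IH; have -> : Posz k.+1 = Posz k + 1 by lia.
  exact: QS.
elim: k => [|k IH]; first by exact: (QP 0).
have -> : Negz k.+1 = Negz k - 1 by lia.
exact: QP.
Qed.

Definition homoclinic (X : topologicalZmodType) (alpha : topAut X) (z : X) :=
  forall U, nbhs 0 U ->
    exists N : nat, forall n : int, (N <= `|n|)%N -> U (aut_iter alpha n z).

Section Iter.
Variables (X : topologicalZmodType) (alpha : topAut X).

Lemma aut_iterS n x : aut_iter alpha (n + 1) x = alpha (aut_iter alpha n x).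
Proof.
case: n => [k|[|k]].
- by have -> : k%:Z + 1 = k.+1 by lia.
- by rewrite /= aut_invK.
- have -> : Negz k.+1 + 1 = Negz k by lia.
  by rewrite /= aut_invK.
Qed.

Lemma aut_iterP n x :
  aut_iter alpha (n - 1) x = aut_inv alpha (aut_iter alpha n x).
Proof. by rewrite -{2}(subrK 1 n) aut_iterS aut_funK. Qed.

Lemma aut_iterB n x y :
  aut_iter alpha n (x - y) = aut_iter alpha n x - aut_iter alpha n y.
Proof.
elim/int_ind_succ_pred: n => // n IH; first by rewrite !aut_iterS IH raddfB.
rewrite !aut_iterP IH; apply: (can_inj (aut_funK alpha)).
by rewrite raddfB !aut_invK.
Qed.

Lemma aut_iterMz n x (k : int) : aut_iter alpha n (x *~ k) = aut_iter alpha n x *~ k.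
Proof.
elim/int_ind_succ_pred: n => [|n IH|n IH] //; first by rewrite !aut_iterS IH raddfMz.
rewrite !aut_iterP IH; apply: (can_inj (aut_funK alpha)).
by rewrite raddfMz !aut_invK.
Qed.

Lemma aut_iter_cont n : continuous (aut_iter alpha n).
Proof.
elim/int_ind_succ_pred: n => [|n IH|n IH]; first by move=> x; exact: cvg_id.
  have -> : aut_iter alpha (n + 1) = alpha \o aut_iter alpha n.
    by apply/funext => y; exact: aut_iterS.
  by move=> x; exact: (cvg_comp _ _ (IH x) (@aut_fun_continuous _ alpha _)).
have -> : aut_iter alpha (n - 1) = aut_inv alpha \o aut_iter alpha n.
  by apply/funext => y; exact: aut_iterP.
by move=> x; exact: (cvg_comp _ _ (IH x) (@aut_inv_continuous _ alpha _)).
Qed.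

Lemma aut_iter_aut n x : aut_iter alpha n (alpha x) = aut_iter alpha (n + 1) x.
Proof.
rewrite aut_iterS; elim/int_ind_succ_pred: n => [|n IH|n IH] //.
  by rewrite !aut_iterS IH.
by rewrite !aut_iterP IH aut_funK aut_invK.
Qed.

Lemma aut_iter0 n : aut_iter alpha n 0 = 0.
Proof. by rewrite -[X in aut_iter _ _ X](subrr 0) aut_iterB subrr. Qed.

Lemma aut_iterD (n : int) (i : nat) x :
  aut_iter alpha (n + i%:Z) x = iter i alpha (aut_iter alpha n x).
Proof.
elim: i => [|i IH]; first by rewrite addr0.
by have -> : n + i.+1%:Z = n + i%:Z + 1 by [lia]; rewrite aut_iterS IH.
Qed.

Lemma aut_iter_surj n x : exists y, aut_iter alpha n y = x.
Proof.
elim/int_ind_succ_pred: n x => [|n IH|n IH] x; first by exists x.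
  have [y yx] := IH (aut_inv alpha x).
  by exists y; rewrite aut_iterS yx aut_invK.
have [y yx] := IH (alpha x).
by exists y; rewrite aut_iterP yx aut_funK.
Qed.

End Iter.

(** * Splicing points of the shift *)

Section Shift.
Variables (A : countType) (P : rel A).
Implicit Types (y u v w : bisequences A).

(** Cylinders around [y] form a filter that converges to [y] coordinate by
    coordinate, hence in the product topology. *)
Lemma nbhs_cylinder y U : nbhs y U ->
  exists N : nat, forall y', (forall n : int, (`|n| <= N)%N -> y' n = y n) -> U y'.
Proof.
pose C (N : nat) : set (bisequences A) :=
  [set y' | forall n : int, (`|n| <= N)%N -> y' n = y n].
have FF : Filter (filter_from [set: nat] C).
  apply: filter_from_filter; first by exists 0%N.
  move=> i j _ _; exists (maxn i j) => // y' Cy'; split=> n nn; apply: Cy'.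
    by rewrite leq_max nn.
  by rewrite leq_max nn orbT.
have cvC : filter_from [set: nat] C --> y.
  apply/cvg_sup => i U' [V [[W oW <-] Wy] WU].
  by exists `|i|%N => // y' /(_ i (leqnn _)) e; apply: WU; rewrite /= e.
by move=> /cvC [N _ CU]; exists N => y' yy'; apply: CU.
Qed.

(** Only the past of [y] matters here: in the induction of [splice_walk] the point
    is extended one symbol at a time, and its future is a placeholder. *)
Definition follows (i : int) y := forall n : int, n < i -> P (y n) (y (n + 1)).

(** Induct on the walk, appending its first symbol to the past of [u]. *)
Lemma splice_walk (l : nat) (i : int) u v :
  follows i u -> sft P v -> walk P l (u i) (v (i + l%:Z)) ->
  exists2 w, sft P w & (forall n, n <= i -> w n = u n) /\
    (forall n, i + l%:Z <= n -> w n = v n).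
Proof.
elim: l i u => [|l IH] i u fu sv [p [szp pp lp]].
  move: szp pp lp => /size0nil -> _ /=; rewrite addr0 => uv.
  exists (fun n => if n < i then u n else v n).
    move=> n /=; case: ltP => ni; case: ltP => n1i.
    + by exact: fu.
    + have e : n + 1 = i by lia.
      by rewrite e -uv -e; exact: fu.
    + lia.
    + exact: sv.
  split=> n ni; case: ltP => // n'i; last by lia.
  by have -> : n = i by lia.
case: p szp pp lp => //= b p [szp] /andP[Pab pp] lp.
pose u' : bisequences A := fun n => if n <= i then u n else b.
have fu' : follows (i + 1) u'.
  move=> n ni; rewrite /u'; have -> : n <= i by lia.
  case: leP => n1i; first by apply: fu; lia.
  by have -> : n = i by lia.
have u'i : u' (i + 1) = b by rewrite /u'; case: leP => //; lia.
have e : i + 1 + l%:Z = i + l.+1%:Z by lia.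
have [|w sw [w1 w2]] := IH (i + 1) u' fu' sv.
  by rewrite u'i e; exists p.
exists w => //; split=> n ni; last by apply: w2; rewrite e.
by rewrite w1 ?/u' ?ni //; lia.
Qed.

Lemma walk_cat l l' a b c : walk P l a b -> walk P l' b c -> walk P (l + l') a c.
Proof.
move=> [p [sp pp lp]] [p' [sp' pp' lp']]; exists (p ++ p').
by rewrite size_cat sp sp' cat_path pp lp pp' last_cat lp.
Qed.

Lemma walk0 a : walk P 0 a a. Proof. by exists [::]. Qed.

Lemma periodic_mul y q (k n : int) :
  (forall m : int, y (m + q) = y m) -> y (n + k * q) = y n.
Proof.
move=> yq; elim/int_ind_succ_pred: k => [|k IH|k IH]; first by rewrite mul0r addr0.
  by rewrite mulrDl mul1r addrA yq.
by rewrite -[LHS]yq -IH; congr y; lia.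
Qed.

(** The loop at [a] is repeated in both directions. *)
Lemma periodic_point q a : (0 < q)%N -> walk P q a a ->
  exists2 p, sft P p & (forall n : int, p (n + q%:Z) = p n) /\ p 0 = a.
Proof.
move=> q0 [s [ss ps ls]].
pose p : bisequences A := fun n => nth a (a :: s) `|(n %% q%:Z)%Z|.
have q0' : q%:Z != 0 by lia.
exists p; last first.
  by split=> [n|]; rewrite /p ?modzDr // mod0z.
move=> n; rewrite /p.
have : (n %% q%:Z)%Z < q%:Z by rewrite ltz_pmod //; lia.
have : 0 <= (n %% q%:Z)%Z by rewrite modz_ge0.
rewrite -(modzDml n 1).
move: (n %% q%:Z)%Z => r r0 rq.
have [r1|r1] := ltP (r + 1) q%:Z.
  rewrite [((r + 1) %% _)%Z]modz_small; last by rewrite r1 andbT; lia.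
  have -> : `|(r + 1)%R|%N = `|r|%N.+1 by lia.
  by apply: (pathP a ps); rewrite ss; lia.
have -> : r + 1 = q%:Z by lia.
rewrite modzz absz0.
have -> : nth a (a :: s) 0%N = nth a (a :: s) (`|r|%N.+1).
  by have -> : `|r|%N.+1 = size s by [rewrite ss; lia]; rewrite -last_nth ls.
by apply: (pathP a ps); rewrite ss; lia.
Qed.
End Shift.

(** Modulo [q] a subsemigroup containing [q] is a subgroup, because [q - 1] times an
    element is its opposite; its least positive representative [e] therefore
    divides every element, and is 1. *)
Lemma semigroup_residues (S : set nat) (q : nat) :
  (0 < q)%N -> S 0%N -> S q -> (forall m n, S m -> S n -> S (m + n)%N) ->
  (forall e, (forall n, S n -> (e %| n)%N) -> (e %| 1)%N) ->
  forall r, exists2 n, S n & n = r %[mod q].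
Proof.
move=> q0 S0 Sq SD Sgcd.
have SM k n : S n -> S (k * n)%N.
  by move=> Sn; elim: k => // k IH; rewrite mulSn; apply: SD.
pose G k := `[< exists2 n, S n & n = k %[mod q] >].
have exG : exists k, (0 < k)%N && G k.
  by exists q; rewrite q0; apply/asboolP; exists q.
case: (ex_minnP exG) => e /andP[e0 /asboolP[m Sm me]] emin.
suff e1 : e = 1%N.
  move=> r; exists (r * m)%N; first exact: SM.
  by rewrite -modnMmr me e1 modnMmr muln1.
apply/eqP; rewrite -dvdn1; apply: Sgcd => n Sn.
apply: contraT; rewrite /dvdn -lt0n => r0.
have /emin : (0 < n %% e)%N && G (n %% e)%N.
  rewrite r0; apply/asboolP; exists (n + q.-1 * (n %/ e) * m)%N.
    by apply: SD => //; apply: SM.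
  rewrite -modnDmr -modnMmr me modnMmr modnDmr.
  have -> : (n + q.-1 * (n %/ e) * e = n %% e + (n %/ e * e) * q)%N.
    rewrite [X in (X + _)%N](divn_eq n e); move: (n %/ e)%N (n %% e)%N => b c.
    by case: q q0 {Sq exG G emin me} => // q _; rewrite /=; nia.
  by rewrite addnC modnMDl.
by rewrite leqNgt ltn_mod e0.
Qed.

(** * Reduction to homoclinic points *)

Section ConstantOnShift.
Variables (X : topologicalZmodType) (alpha : topAut X).
Variables (A : countType) (P : rel A) (phi : bisequences A -> X).
Hypothesis phi_cont : {within sft P, continuous phi}.
Hypothesis phi_equiv : forall y, sft P y -> phi (shift_seq y) = alpha (phi y).
Hypothesis hausX : hausdorff_space X.

Definition shift_by (k : int) (y : bisequences A) : bisequences A :=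
  fun n => y (n + k).

Lemma sft_shift_by k y : sft P y -> sft P (shift_by k y).
Proof. by move=> sy n; rewrite /shift_by addrAC; exact: sy. Qed.

Lemma phi_shift_by k y : sft P y -> phi (shift_by k y) = aut_iter alpha k (phi y).
Proof.
move=> sy; elim/int_ind_succ_pred: k => [|k IH|k IH].
- by congr phi; apply/funext => n; rewrite /shift_by addr0.
- rewrite aut_iterS -IH -phi_equiv; last exact: sft_shift_by.
  by congr phi; apply/funext => n; rewrite /shift_seq /shift_by addrAC addrA.
- rewrite aut_iterP -IH; apply: (can_inj (aut_funK alpha)).
  rewrite aut_invK -phi_equiv; last exact: sft_shift_by.
  by congr phi; apply/funext => n; rewrite /shift_seq /shift_by; congr (y _); lia.
Qed.

Lemma phi_window y U : sft P y -> nbhs (phi y) U ->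
  exists N : nat, forall y', sft P y' ->
    (forall n : int, (`|n| <= N)%N -> y' n = y n) -> U (phi y').
Proof.
move=> sy Uy; have /subspace_continuousP/(_ y sy U Uy) := phi_cont.
rewrite /= !nbhs_simpl /within /= => /nbhs_cylinder[N NP].
by exists N => y' sy' yy'; exact: NP.
Qed.

(** The iterates of [p] are finitely many, so continuity of [phi] at each of them
    gives one window size that works for all; far from the origin [w] and [p]
    agree on such a window. *)
Lemma homoclinic_image q p w M : (0 < q)%N -> sft P p -> sft P w ->
  (forall n : int, p (n + q%:Z) = p n) ->
  (forall n : int, (M <= `|n|)%N -> w n = p n) ->
  homoclinic alpha (phi w - phi p).
Proof.
move=> q0 sp sw pq wp U U0.
have pqn (k n : int) : p (n + k * q%:Z) = p n by exact: periodic_mul.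
have win (j : nat) : exists N : nat, forall y', sft P y' ->
    (forall n : int, (`|n| <= N)%N -> y' n = shift_by j p n) ->
    U (phi y' - phi (shift_by j p)).
  apply: (@phi_window _ (fun x => U (x - phi (shift_by j p)))).
    exact: sft_shift_by.
  have : (fun x => x - phi (shift_by j p)) @ phi (shift_by j p) --> (0 : X).
    rewrite -[X in _ --> X](subrr (phi (shift_by j p))).
    by apply: cvg_add_group; [exact: cvg_id|exact: cvg_cst].
  by move/(_ U U0).
have [Nf NfP] := choice win.
exists (M + \max_(j < q) Nf j)%N => n nM.
rewrite aut_iterB -!phi_shift_by //.
have q0' : q%:Z != 0 by lia.
pose j := `|(n %% q%:Z)%Z|%N.
have jE : n = (n %/ q%:Z)%Z * q%:Z + j%:Z.
  by rewrite /j gez0_abs ?modz_ge0 // -divz_eq.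
have jq : (j < q)%N.
  by have := ltz_pmod n (_ : 0 < q%:Z); have := modz_ge0 n q0'; rewrite /j; lia.
have -> : shift_by n p = shift_by j p.
  by apply/funext => m; rewrite /shift_by {1}jE addrCA addrC pqn.
apply: NfP; first exact: sft_shift_by.
move=> m mN; rewrite /shift_by wp.
  by rewrite {1}jE addrCA addrC pqn.
have : (Nf j <= \max_(j < q) Nf j)%N by exact: (leq_bigmax (Ordinal jq)).
lia.
Qed.

(** A loop at [b] is made into a loop at [a] by a detour, so the common divisors of
    the loops at one symbol divide all return lengths. *)
Lemma mixing_loops a : mixing_sft P -> forall e,
  (forall n, walk P n a a -> (e %| n)%N) -> (e %| 1)%N.
Proof.
move=> [irr [_ hcf]] e ea; apply: hcf => n [_ [b wb]].
have [m1 [_ w1]] := irr a b; have [m2 [_ w2]] := irr b a.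
have d12 := ea _ (walk_cat w1 w2).
have := ea _ (walk_cat w1 (walk_cat wb w2)).
by rewrite addnCA dvdn_addl.
Qed.

(** Given [y] and a window, enter the window from the periodic point and leave it
    back to the periodic point.  Loops at [a] of every residue modulo [q] allow both
    connections to respect the phase of [p]. *)
Lemma constant_on_mixing_sft : mixing_sft P ->
  (forall z, homoclinic alpha z -> z = 0) ->
  exists x0 : X, phi @` sft P = [set x0].
Proof.
move=> mix hom0; have [irr [_ hcf]] := mix.
have [q [q0 [a wa]]] : return_length P !=set0.
  apply/set0P/eqP => S0; suff : (2 %| 1)%N by [].
  by apply: hcf => n; rewrite S0.
have [p sp [pq p0]] := periodic_point q0 wa.
have pqn (k n : int) : p (n + k * q%:Z) = p n by exact: periodic_mul.
have pk (k : int) : p (k * q%:Z) = a by rewrite -[k * _]add0r pqn p0.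
have res r : exists2 n, walk P n a a & n = r %[mod q].
  apply: semigroup_residues => //; first exact: walk0.
    by move=> m n; exact: walk_cat.
  exact: mixing_loops.
have phi_p y : sft P y -> phi y = phi p.
  move=> sy; apply: (hausX) => U V /(phi_window sy)[N NP] pV.
  suff [w [sw wy [M wM]]] : exists w, [/\ sft P w,
      forall n : int, (`|n| <= N)%N -> w n = y n &
      exists M : nat, forall n : int, (M <= `|n|)%N -> w n = p n].
    exists (phi w); split; first exact: NP.
    suff -> : phi w = phi p by exact: nbhs_singleton.
    by apply/eqP; rewrite -subr_eq0; apply/eqP/hom0; exact: (homoclinic_image q0 sp sw pq wM).
  have [l1 [_ w1]] := irr a (y (- N%:Z)).
  have [l2 [_ w2]] := irr (y N%:Z) a.
  (* The loop lengths are chosen so that [l + m + N] is divisible by [q], which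
     puts the ends of the window at positions where [p] shows [a]. *)
  have [m1 wm1 /eqP em1] := res (q * (l1 + N) - (l1 + N))%N.
  have [m2 wm2 /eqP em2] := res (q * (l2 + N) - (l2 + N))%N.
  have [k1 k1E] : exists k1 : int, - N%:Z - (m1 + l1)%:Z = k1 * q%:Z.
    move: em1; rewrite -(eqn_modDr (l1 + N)) subnK ?leq_pmull // modnMr.
    rewrite -/(dvdn _ _) => /dvdnP[k kE]; exists (- k%:Z).
    by rewrite mulNr -PoszM -kE; lia.
  have [k2 k2E] : exists k2 : int, N%:Z + (l2 + m2)%:Z = k2 * q%:Z.
    move: em2; rewrite -(eqn_modDr (l2 + N)) subnK ?leq_pmull // modnMr.
    rewrite -/(dvdn _ _) => /dvdnP[k kE]; exists (k%:Z).
    by rewrite -PoszM -kE; lia.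
  have [||u su [u1 u2]] := @splice_walk _ P (m1 + l1)%N (k1 * q%:Z) p y _ sy.
  - by move=> n _; exact: sp.
  - rewrite pk -k1E subrK; exact: walk_cat w1.
  have [||w sw [w1' w2']] := @splice_walk _ P (l2 + m2)%N N%:Z u p _ sp.
  - by move=> n _; exact: su.
  - rewrite k2E pk u2; last by lia.
    exact: walk_cat wm2.
  exists w; split=> //.
    by move=> n nN; rewrite w1' ?u2 //; lia.
  exists (N + m1 + l1 + m2 + l2)%N => n nM.
  have [n0|n0] := leP n 0.
    by rewrite w1' ?u1 //; lia.
  by rewrite w2' //; lia.
exists (phi p); apply/seteqP; split=> [_ [y sy <-]|_ ->].
  exact: phi_p.
by exists p.
Qed.

End ConstantOnShift.

(** * The Haar integral as an invariant mean *)

(** All that is used of the Haar measure: translation invariant integration of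
    continuous functions. *)
Record invariant_mean (R : realType) (X : topologicalZmodType)
    (I : (X -> R) -> R) : Prop := InvariantMean {
  meanD : forall f g : X -> R, continuous f -> continuous g ->
    I (fun x => f x + g x) = I f + I g;
  meanZ : forall (a : R) (f : X -> R), continuous f ->
    I (fun x => a * f x) = a * I f;
  mean1 : I (fun=> 1) = 1;
  mean_ge0 : forall f : X -> R, continuous f -> (forall x, 0 <= f x) -> 0 <= I f;
  mean_shift : forall (f : X -> R) y, continuous f -> I (fun x => f (x + y)) = I f }.

Section Haar.
Variables (R : realType) (X : topologicalZmodType).
Variable mu : probability (borel X) R.
Hypotheses (compX : compact [set: X]) (haar_mu : is_haar mu).

Lemma continuous_borel (T : topologicalType) (f : X -> T) (B : set T) :
  continuous f -> open B -> measurable (f @^-1` B : set (borel X)).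
Proof. by move=> /continuousP cf /cf oB; apply: sub_sigma_algebra. Qed.

Lemma continuous_measurable (f : X -> R) : continuous f ->
  measurable_fun [set: borel X] (f : borel X -> R).
Proof.
move=> cf; apply: (measurability _ (RGenOInfty.measurableE R)).
move=> _ [_ [r ->] <-]; rewrite setTI.
by apply: continuous_borel => //; exact: interval_open.
Qed.

Lemma continuous_integrable (f : X -> R) : continuous f ->
  mu.-integrable [set: borel X] (EFin \o (f : borel X -> R)).
Proof.
move=> cf; apply: measurable_bounded_integrable => //.
- by rewrite (le_lt_trans (probability_le1 _ _)) // ltry.
- exact: continuous_measurable.
have /compact_bounded[M [Mr mrt]] :
    compact [set f x | x in [set: X]].
  by apply: continuous_compact => //; exact: continuous_subspaceT.
by exists M; split => // r Mr' x _; apply: (mrt _ Mr'); exists x.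
Qed.

Lemma haar_mean :
  invariant_mean (fun f : X -> R => Rintegral mu [set: borel X] f).
Proof.
split.
- by move=> f g cf cg; rewrite RintegralD //; exact: continuous_integrable.
- by move=> a f cf; rewrite RintegralZl //; exact: continuous_integrable.
- by rewrite Rintegral_cst // mul1r [X in fine X](@probability_setT _ _ _ mu).
- by move=> f cf f0; apply: Rintegral_ge0.
move=> f y cf.
have cy : continuous (fun x : X => x + y).
  by move=> x; apply: cvg_add_group; [exact: cvg_id|exact: cvg_cst].
have my : measurable_fun [set: borel X] ((fun x : X => x + y) : borel X -> borel X).
  apply: (@measurability _ _ (borel X) (borel X) _ _ (@open X)) => //.
  by move=> _ [B oB <-]; rewrite setTI; exact: continuous_borel.
rewrite /Rintegral; congr fine.
have := @integral_pushforward _ _ _ _ R _ my mu [set: borel X] (fun x => (f x)%:E).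
rewrite preimage_setT => <- //.
- apply: eq_measure_integral => B mB _; rewrite /pushforward.
  rewrite -[RHS](haar_mu.1 (- y) B mB); congr (mu _).
  apply/seteqP; split=> [x Bx|_ [b Bb <-]] /=.
    by exists (x + y) => //; rewrite addrCA addNr addr0.
  by rewrite addrAC addNr add0r.
- by apply/measurable_EFinP; exact: continuous_measurable.
- have := @continuous_integrable (fun x => f (x + y)); apply.
  by move=> x; apply: continuous_comp; [exact: cy|exact: cf].
Qed.

End Haar.

Section MeanTheory.
Variables (R : realType) (X : topologicalZmodType) (I : (X -> R) -> R).
Hypotheses (compX : compact [set: X]) (mI : invariant_mean I).
Implicit Types (f g : X -> R).

Lemma mean_const a : I (fun=> a) = a.
Proof.
rewrite -[RHS]mulr1 -[in RHS](mean1 mI) -(meanZ mI); last exact: cont_const.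
by congr I; apply/funext => x; rewrite mulr1.
Qed.

Lemma meanN f : continuous f -> I (fun x => - f x) = - I f.
Proof.
by move=> cf; rewrite -mulN1r -(meanZ mI) //; congr I; apply/funext=> x; rewrite mulN1r.
Qed.

Lemma meanB f g : continuous f -> continuous g ->
  I (fun x => f x - g x) = I f - I g.
Proof. by move=> cf cg; rewrite (meanD mI) ?meanN //; cont. Qed.

Lemma mean_le f g : continuous f -> continuous g -> (forall x, f x <= g x) ->
  I f <= I g.
Proof.
move=> cf cg fg; rewrite -subr_ge0 -meanB //; apply: (mean_ge0 mI); first by cont.
by move=> x; rewrite subr_ge0.
Qed.

Lemma mean_norm_le f e : continuous f -> (forall x, `|f x| <= e) -> `|I f| <= e.
Proof.
move=> cf fe; rewrite ler_norml -{1}[e]mean_const -meanN; last exact: cont_const.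
rewrite -{2}[e]mean_const; apply/andP; split; apply: mean_le; cont;
by move=> x; have := fe x; rewrite ler_norml => /andP[].
Qed.

Lemma mean_dist_le f g e : continuous f -> continuous g ->
  (forall x, `|f x - g x| <= e) -> `|I f - I g| <= e.
Proof. by move=> cf cg fg; rewrite -meanB //; apply: mean_norm_le => //; cont. Qed.

(** Haar measure has full support: finitely many translates of the set where [f]
    exceeds half of a positive value cover the group. *)
Lemma mean_eq0 f : continuous f -> (forall x, 0 <= f x) -> I f = 0 ->
  forall x, f x = 0.
Proof.
move=> cf f0 If0 x0; apply/eqP; apply: contraT => fx0.
have e0 : 0 < f x0 / 2 by rewrite divr_gt0 // lt_neqAle eq_sym fx0 f0.
have [|s sP] := @finite_cover X compX (fun u => f x0 / 2 < f (x0 + u)).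
  have := @cont_shiftl X R f x0 cf (0 : X); rewrite /continuous_at addr0.
  move/cvgrPdist_lt/(_ _ e0); apply: filterS => u /=.
  by rewrite ltr_distlC => /andP[]; lra.
pose g := fun x => \sum_(y <- s) f (x + (x0 - y)).
have [cg Ig] : continuous g /\ I g = 0.
  rewrite /g; elim: (s) => [|y s' [cg Ig]].
    under eq_fun do rewrite big_nil.
    by split; [exact: cont_const|rewrite mean_const].
  under eq_fun do rewrite big_cons.
  split; first by cont.
  by rewrite (meanD mI) ?Ig ?(mean_shift mI) ?If0 ?addr0 //; cont.
suff : f x0 / 2 <= I g by rewrite Ig leNgt e0.
rewrite -[X in X <= _]mean_const; apply: mean_le => //; first exact: cont_const.
move=> x; have [y ys fy] := sP x; apply: (le_trans (ltW fy)).
rewrite /g (big_rem y) //= addrCA lerDl.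
by apply: sumr_ge0.
Qed.

End MeanTheory.

(** * Positive definite functions *)

(** Finite families of weighted points are lists of pairs, so that a family can be
    doubled by concatenation. *)
Definition gram (R : pzRingType) (X : zmodType) (p : X -> R) (s : seq (R * X)) :=
  \sum_(u <- s) \sum_(v <- s) u.1 * v.1 * p (u.2 - v.2).

Record pos_def (R : realType) (X : topologicalZmodType) (p : X -> R) : Prop :=
 PosDef {
  pos_def_cont : continuous p;
  pos_def_even : forall x, p (- x) = p x;
  pos_def_gram : forall s : seq (R * X), 0 <= gram p s }.

Section PosDefTheory.
Variables (R : realType) (X : topologicalZmodType).
Implicit Types (p q : X -> R).

(** Test the form on the points [x] and 0 with weights 1 and [b = 1, -1]. *)
Lemma pos_def_norm_le p x : pos_def p -> `|p x| <= p 0.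
Proof.
move=> [_ ev gr].
have g b := gr [:: (1, x); (b, 0)].
have := g 1; have := g (-1); rewrite /gram !big_cons !big_nil /=.
rewrite !subrr !subr0 !sub0r ev ler_norml; lra.
Qed.

Lemma pos_def_scale p a : pos_def p -> 0 <= a -> pos_def (fun x => a * p x).
Proof.
move=> [cp ev gr] a0; split; first by cont.
  by move=> x; rewrite ev.
move=> s; suff -> : gram (fun x => a * p x) s = a * gram p s by rewrite mulr_ge0.
rewrite /gram mulr_sumr; apply: eq_bigr => u _; rewrite mulr_sumr.
by apply: eq_bigr => v _; rewrite mulrCA.
Qed.

(** On the Fourier side this multiplies the coefficient of [chi] by
    [2 + 2 b Re (chi y)], which is nonnegative; the form of the result on [s] is the
    form of [p] on [s] together with its translate by [y], weighted by [b]. *)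
Lemma pos_def_twist p b y : pos_def p -> b ^+ 2 = 1 ->
  pos_def (fun x => 2 * p x + b * (p (x + y) + p (x - y))).
Proof.
move=> [cp ev gr] b2; split; first by cont.
  move=> x; have -> : p (- x + y) = p (x - y) by rewrite -ev opprD opprK.
  have -> : p (- x - y) = p (x + y) by rewrite -ev opprD !opprK.
  by rewrite ev [p (x - y) + _]addrC.
move=> s; have := gr (s ++ [seq (b * u.1, u.2 + y) | u <- s]).
congr (0 <= _); rewrite /gram !big_cat /= !big_map /=.
under eq_bigr do rewrite big_cat big_map /=.
under [X in _ + X]eq_bigr do rewrite big_cat big_map /=.
rewrite -big_split /=; apply: eq_bigr => u _.
rewrite -!big_split /=; apply: eq_bigr => v _.
have -> : u.2 - (v.2 + y) = u.2 - v.2 - y by rewrite opprD addrA.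
have -> : u.2 + y - v.2 = u.2 - v.2 + y by rewrite addrAC.
have -> : u.2 + y - (v.2 + y) = u.2 - v.2 by rewrite opprD addrACA subrr addr0.
by ring: b2.
Qed.

Lemma pos_def_closed p : (forall e : R, 0 < e -> exists2 q, pos_def q &
  forall x, `|p x - q x| <= e) -> pos_def p.
Proof.
move=> pq; split.
- move=> x; apply/cvgrPdist_le => e e0.
  have e3 : 0 < e / 3 by rewrite divr_gt0.
  have [q [cq _ _] qp] := pq _ e3.
  have /cvgrPdist_le/(_ _ e3) := cq x; apply: filterS => y.
  have := qp x; have := qp y; rewrite !ler_norml => /andP[? ?] /andP[? ?] /andP[? ?].
  apply/andP; split; lra.
- move=> x; apply/eqP; rewrite -subr_eq0 -normr_le0; apply/ler_addgt0Pr => e e0.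
  have e3 : 0 < e / 2 by rewrite divr_gt0.
  have [q [_ ev _] qp] := pq _ e3.
  have := qp x; have := qp (- x); rewrite ev add0r.
  rewrite !ler_norml => /andP[? ?] /andP[? ?].
  by apply/andP; split; lra.
move=> s; rewrite -oppr_le0; apply/ler_addgt0Pr => e e0; rewrite add0r.
pose M := 1 + \sum_(u <- s) \sum_(v <- s) `|u.1 * v.1|.
have M0 : 0 < M by rewrite ltr_pwDl // !sumr_ge0 // => u _; rewrite sumr_ge0.
have [q [_ _ gr] qp] := pq _ (divr_gt0 e0 M0).
suff : `|gram p s - gram q s| <= e.
  by have := gr s; rewrite ler_norml => ? /andP[? ?]; lra.
rewrite /gram -sumrB; apply: (@le_trans _ _ (M * (e / M))); last first.
  by rewrite mulrC divfK // gt_eqF.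
apply: (@le_trans _ _ ((\sum_(u <- s) \sum_(v <- s) `|u.1 * v.1|) * (e / M))).
  rewrite mulr_suml; apply: le_trans (ler_norm_sum _ _ _) _; apply: ler_sum => u _.
  rewrite mulr_suml -sumrB; apply: le_trans (ler_norm_sum _ _ _) _; apply: ler_sum => v _.
  by rewrite -mulrBr normrM ler_wpM2l.
by rewrite ler_wpM2r ?divr_ge0 ?(ltW e0) ?(ltW M0) // /M lerDr.
Qed.

End PosDefTheory.

(** * Correlation against a kernel *)

Section Correlation.
Variables (R : realType) (X : topologicalZmodType) (I : (X -> R) -> R).
Hypotheses (compX : compact [set: X]) (mI : invariant_mean I).
Implicit Types (f g h p q : X -> R).

Definition corr h p x := I (fun y => h y * p (x + y)).

Lemma corr_shift h p x u : continuous h -> continuous p ->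
  corr h p (x + u) = I (fun y => h (y - u) * p (x + y)).
Proof.
move=> ch cp; rewrite -[RHS](mean_shift mI u); last by cont.
congr I; apply/funext => y; rewrite addrK; congr (_ * p _).
by rewrite -addrA [u + y]addrC.
Qed.

(** By [corr_shift] the modulus of continuity of [corr h p] is that of [h],
    uniformly in [p] bounded by 1. *)
Lemma corr_equicontinuous h (e : R) : continuous h -> 0 < e ->
  \forall u \near (0 : X), forall p, continuous p -> (forall x, `|p x| <= 1) ->
    forall x, `|corr h p (x + u) - corr h p x| <= e.
Proof.
move=> ch e0; have : \forall u \near (0 : X), forall x, `|h (x - u) - h x| < e.
  have := @opp_continuous X 0; rewrite /continuous_at oppr0 => oc.
  exact: (oc _ (cont_uniform compX ch e0)).
apply: filterS => u hu p cp p1 x; rewrite corr_shift //.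
apply: mean_dist_le => //; try by cont.
move=> y; rewrite -mulrBl normrM -[e]mulr1.
by apply: ler_pM => //; exact: ltW.
Qed.

Lemma corr_cont h p : continuous h -> continuous p -> continuous (corr h p).
Proof.
move=> ch cp x; apply/cvgrPdist_le => e e0.
have [M M0 hM] := cont_bounded compX ch.
have := cont_uniform compX cp (divr_gt0 e0 M0) => pe.
have : \forall u \near x, forall y, `|p (y + (u - x)) - p y| < e / M.
  exact: (nbhs_shift x pe).
apply: filterS => u hu; rewrite distrC; apply: mean_dist_le => //; try by cont.
move=> y; rewrite -mulrBr normrM -[e](divfK (lt0r_neq0 M0)) [e / M * _]mulrC.
apply: ler_pM => //; have := hu (x + y).
have -> : x + y + (u - x) = u + y by rewrite addrC addrA subrK.
by move=> /ltW.
Qed.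

(** The form is the mean of the square of [\sum_u u.1 * g (u.2 + y)], as one sees by
    translating each term by [v.2]. *)
Lemma corr_pos_def g : continuous g -> pos_def (corr g g).
Proof.
move=> cg; split.
- exact: corr_cont.
- move=> x; rewrite -[LHS](mean_shift mI x); last by cont.
  rewrite /corr; congr I; apply/funext => y.
  by rewrite [- x + _]addrC addrK mulrC [y + x]addrC.
move=> s; suff -> : gram (corr g g) s =
    I (fun y => (\sum_(u <- s) u.1 * g (u.2 + y)) ^+ 2).
  apply: (mean_ge0 mI) => [|x]; last exact: sqr_ge0.
  suff c : continuous (fun y => \sum_(u <- s) u.1 * g (u.2 + y)).
    by rewrite (_ : (fun _ => _) = fun y => (\sum_(u <- s) u.1 * g (u.2 + y)) *
      (\sum_(u <- s) u.1 * g (u.2 + y))) //; cont.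
  elim: s => [|v s IH]; first by under eq_fun do rewrite big_nil; cont.
  by under eq_fun do rewrite big_cons; cont.
have sumI (s' : seq (R * X)) (k : R * X -> X -> R) : (forall u, continuous (k u)) ->
    continuous (fun y => \sum_(u <- s') k u y) /\
    \sum_(u <- s') I (k u) = I (fun y => \sum_(u <- s') k u y).
  move=> ck; elim: s' => [|v s' [IH1 IH2]].
    under eq_fun do rewrite big_nil; rewrite big_nil (mean_const mI).
    by split=> //; cont.
  under eq_fun do rewrite big_cons; rewrite big_cons IH2; split; first by cont.
  by rewrite (meanD mI).
have cK (u v : R * X) :
  continuous (fun y => u.1 * g (u.2 + y) * (v.1 * g (v.2 + y))) by cont.
rewrite /gram; transitivity (\sum_(u <- s) I (fun y =>
   \sum_(v <- s) u.1 * g (u.2 + y) * (v.1 * g (v.2 + y)))).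
  apply: eq_bigr => u _; rewrite -(sumI _ _ (cK u)).2; apply: eq_bigr => v _.
  rewrite -[corr _ _ _](mean_shift mI v.2); last by cont.
  rewrite -(meanZ mI); last first.
    apply: cont_mul; first by cont.
    by apply: (@cont_shiftr X R (fun z => g (u.2 - v.2 + z)) v.2); cont.
  congr I; apply/funext => y.
  by rewrite [y + v.2]addrC addrA subrK; ring.
rewrite (sumI _ _ (fun u => (sumI _ _ (cK u)).1)).2; congr I.
apply/funext => y; rewrite expr2 mulr_suml; apply: eq_bigr => u _.
by rewrite mulr_sumr.
Qed.

(** The value of the functional [p |-> I (h * p)] on the twist of [p] by [y]; it
    brings in the correlation at [y]. *)
Lemma corr_twist h p b y : continuous h -> continuous p ->
  I (fun x => h x * (2 * p x + b * (p (x + y) + p (x - y)))) =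
  2 * I (fun x => h x * p x) + b * (corr h p y + corr h p (- y)).
Proof.
move=> ch cp; rewrite /corr -(meanD mI); try by cont.
rewrite -!(meanZ mI); try by cont.
rewrite -(meanD mI); try by cont.
congr I; apply/funext => x; rewrite [y + x]addrC [- y + x]addrC; ring.
Qed.

End Correlation.

(** * Maximizing sequences are precompact *)

Section Extremal.
Variables (R : realType) (X : topologicalZmodType) (I : (X -> R) -> R).
Hypotheses (compX : compact [set: X]) (mI : invariant_mean I).
Variables (h : X -> R) (r : R).
Hypotheses (ch : continuous h) (r0 : 0 < r).
Implicit Types (p q : X -> R).
Let F p := I (fun x => h x * p x).
Hypothesis Fle : forall q, pos_def q -> F q <= r * q 0.

(** The average over [x] and [- x] replaces evenness of [corr I h p], which would
    ask the mean to be invariant under inversion. *)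
Definition sym_corr p x := (corr I h p x + corr I h p (- x)) / 2.

(** The bound [Fle] for the two twists of [p] by [x] bounds the defect of the
    eigenvalue equation at [x] by the defect of [p] as a maximizer of [F]. *)
Lemma almost_eigen p x : pos_def p ->
  `|r * p x - sym_corr p x| <= r * p 0 - F p.
Proof.
move=> pdp; have [cp ev _] := pdp; rewrite /sym_corr.
have tw b : b ^+ 2 = 1 -> 2 * F p + b * (corr I h p x + corr I h p (- x)) <=
    r * (2 * p 0 + b * (2 * p x)).
  move=> b2; rewrite -(corr_twist mI) //; have := Fle (pos_def_twist x pdp b2).
  by rewrite add0r sub0r ev [2 * p x]mulr_natl mulr2n.
have := tw 1 (expr1n _ _); have := tw (-1); rewrite sqrrN expr1n => /(_ erefl).
by move=> t1 t2; rewrite ler_norml; apply/andP; split; lra.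
Qed.

Lemma ptws_nbhs (p : prod_topology (fun _ : X => (R : topologicalType)))
    (s : seq X) (d : R) :
  0 < d -> nbhs p [set f | forall x, x \in s -> `|p x - f x| < d].
Proof.
move=> d0; have FF : Filter (nbhs p) by exact: nbhs_filter.
elim: s => [|x s IH].
  rewrite (_ : mkset _ = setT); first exact: filterT.
  by apply/seteqP; split.
have := @proj_continuous X (fun _ => (R : topologicalType)) x p.
rewrite /continuous_at => /cvgrPdist_lt/(_ d d0) nx.
apply: filterS (filterI nx IH) => f [fx fs] y.
by rewrite inE => /predU1P[->|/fs].
Qed.

(** By [almost_eigen] the tail of a maximizing sequence is uniformly close to
    functions [sym_corr (pn n) / r], which are equicontinuous.  So a pointwise
    cluster point, given by Tychonoff's theorem, is uniformly approximated: check a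
    finite net, then compare nearby points. *)
Lemma extremal_cluster (pn : nat -> X -> R) :
  (forall n, pos_def (pn n) /\ pn n 0 = 1) ->
  (forall e, 0 < e -> exists N : nat, forall n, (N <= n)%N -> r - F (pn n) <= e) ->
  exists p, [/\ pos_def p, p 0 = 1 & forall e N, 0 < e ->
    exists2 n, (N <= n)%N & forall x, `|p x - pn n x| <= e].
Proof.
move=> pdn Fn.
have pn1 n x : `|pn n x| <= 1.
  by rewrite -(pdn n).2; apply: pos_def_norm_le; exact: (pdn n).1.
have cK : compact [set f : prod_topology (fun _ : X => (R : topologicalType)) |
    forall x, `[-1, 1]%classic (f x)].
  by apply: (@tychonoff X (fun=> (R : topologicalType)) (fun=> `[-1, 1]%classic))
    => x; exact: segment_compact.
have [|p [_ pcl]] := cK (pn @ \oo) _.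
  by exists 0%N => // n _ x /=; rewrite in_itv /= -ler_norml.
have pclP (e : R) N (s : seq X) : 0 < e -> exists2 n, (N <= n)%N &
    forall x, x \in s -> `|p x - pn n x| < e.
  move=> e0; have [|f [[n nN <-] fs]] :=
      pcl [set f | exists2 n, (N <= n)%N & pn n = f] _ _ (ptws_nbhs p s e0).
    by exists N => // n nN; exists n.
  by exists n.
have unif (e : R) N : 0 < e -> exists2 n, (N <= n)%N & forall x, `|p x - pn n x| <= e.
  move=> e0; pose d := e / 9; have d0 : 0 < d by rewrite divr_gt0.
  have rd0 : 0 < r * d by rewrite mulr_gt0.
  have [N1 N1P] := Fn _ rd0.
  pose N2 := maxn N N1.
  have eigen n x : (N2 <= n)%N -> `|r * pn n x - sym_corr (pn n) x| <= r * d.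
    rewrite geq_max => /andP[_ n1]; apply: le_trans (almost_eigen _ (pdn n).1) _.
    by rewrite (pdn n).2 mulr1; exact: N1P.
  have ue := corr_equicontinuous compX mI ch rd0.
  have ue' : \forall u \near (0 : X), forall q, continuous q ->
     (forall x, `|q x| <= 1) -> forall x, `|corr I h q (x - u) - corr I h q x| <= r * d.
    have := @opp_continuous X 0; rewrite /continuous_at oppr0 => oc.
    exact: (oc _ ue).
  have [s sP] := finite_cover compX (filterI ue ue').
  have equi n x y : (N2 <= n)%N -> y \in s ->
      (forall q, continuous q -> (forall x, `|q x| <= 1) ->
        forall z, `|corr I h q (z + (x - y)) - corr I h q z| <= r * d) ->
      (forall q, continuous q -> (forall x, `|q x| <= 1) ->
        forall z, `|corr I h q (z - (x - y)) - corr I h q z| <= r * d) ->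
      `|pn n x - pn n y| <= 3 * d.
    move=> nN ys u1 u2; have cpn := pos_def_cont (pdn n).1.
    have := u1 _ cpn (pn1 n) y; have := u2 _ cpn (pn1 n) (- y).
    have -> : y + (x - y) = x by rewrite addrC subrK.
    have -> : - y - (x - y) = - x by rewrite opprB addrA addNr add0r.
    have := eigen n x nN; have := eigen n y nN; rewrite /sym_corr.
    rewrite !ler_norml => /andP[? ?] /andP[? ?] /andP[? ?] /andP[? ?].
    by apply/andP; split; rewrite -(ler_pM2l r0); lra.
  have [n nN ns] := pclP d N2 s d0.
  exists n; first by apply: leq_trans nN; rewrite leq_max leqnn.
  move=> x; have [y ys [u1 u2]] := sP x.
  have [m mN ms] := pclP d N2 [:: x; y] d0.
  have := equi n x y nN ys u1 u2; have := equi m x y mN ys u1 u2.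
  have := ns y ys; have := ms x; have := ms y.
  rewrite !inE !eqxx orbT => /(_ isT) + /(_ isT).
  rewrite !ltr_norml !ler_norml /d => /andP[? ?] /andP[? ?] /andP[? ?] /andP[? ?] /andP[? ?].
  by apply/andP; split; lra.
exists p; split=> //.
  apply: pos_def_closed => e e0; have [n _ nP] := unif e 0%N e0.
  by exists (pn n); [exact: (pdn n).1|exact: nP].
apply/eqP; rewrite -subr_eq0 -normr_le0; apply/ler_addgt0Pr => e e0.
have [n _ nP] := unif e 0%N e0.
by have := nP 0; rewrite (pdn n).2 add0r.
Qed.

End Extremal.

(** * An extremal solution of d'Alembert's equation *)

Section Cosine.
Variables (R : realType) (X : topologicalZmodType) (I : (X -> R) -> R).
Hypotheses (compX : compact [set: X]) (mI : invariant_mean I).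
Implicit Types (g p q : X -> R).

(** The direct method: a maximizing sequence in [D] has a uniform cluster point in
    [D], and [G] is Lipschitz for uniform distance. *)
Lemma sup_attained (D : set (X -> R)) (G : (X -> R) -> R) (K M : R) :
  D !=set0 -> 0 < K -> (forall p, D p -> continuous p) ->
  (forall p, D p -> G p <= M) ->
  (forall p q e, continuous p -> continuous q -> (forall x, `|p x| <= 1) ->
     (forall x, `|q x| <= 1) -> (forall x, `|p x - q x| <= e) ->
     `|G p - G q| <= K * e) ->
  (forall p, D p -> forall x, `|p x| <= 1) ->
  (forall pn : nat -> X -> R, (forall n, D (pn n)) ->
     (forall e, 0 < e -> exists N : nat, forall n, (N <= n)%N ->
        sup (G @` D) - G (pn n) <= e) ->
     exists p, [/\ continuous p, (forall x, `|p x| <= 1) & forall e N, 0 < e ->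
       exists2 n, (N <= n)%N & forall x, `|p x - pn n x| <= e] /\ D p) ->
  exists2 p, D p & forall q, D q -> G q <= G p.
Proof.
move=> [p0 Dp0] K0 Dc DM Glip D1 Dcomp.
have supG : has_sup (G @` D).
  by split; [exists (G p0), p0|exists M => _ [p Dp <-]; exact: DM].
have Gsup q : D q -> G q <= sup (G @` D).
  by move=> Dq; apply: sup_upper_bound => //; exists q.
have app (n : nat) : exists p, D p /\ sup (G @` D) - n.+1%:R^-1 < G p.
  have [|_ [p Dp <-] Gp] := @sup_adherent _ (G @` D) n.+1%:R^-1 _ supG.
    by rewrite invr_gt0.
  by exists p.
have [pn pnP] := choice app.
have arch (e : R) : 0 < e -> exists N : nat, forall n, (N <= n)%N -> n.+1%:R^-1 <= e.
  move=> e0; have [N _ NP] := near_infty_natSinv_lt (PosNum e0).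
  by exists N => n nN; apply: ltW; exact: NP.
have tail e : 0 < e -> exists N : nat, forall n, (N <= n)%N ->
    sup (G @` D) - G (pn n) <= e.
  move=> /arch[N NP]; exists N => n nN; apply: le_trans (NP n nN).
  by rewrite lerBlDr -lerBlDl; exact: ltW (pnP n).2.
have [p [[cp p1 pP] Dp]] := Dcomp pn (fun n => (pnP n).1) tail.
exists p => // q /Gsup Gq; apply: le_trans Gq _; apply/ler_addgt0Pr => e e0.
have e2 : 0 < e / 2 by rewrite divr_gt0.
have [N NP] := tail _ e2.
have eK : 0 < e / 2 / K by rewrite divr_gt0.
have [n nN np] := pP _ N eK.
have := Glip p (pn n) _ cp (Dc _ (pnP n).1) p1 (D1 _ (pnP n).1) np.
rewrite mulrC divfK ?lt0r_neq0 // ler_norml => /andP[? ?].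
by have := NP n nN; lra.
Qed.

(** The point [p] is a convex combination, with weights [(1 + p y) / 2] and
    [(1 - p y) / 2], of its two normalized twists [P] and [Q] by [y].  The mean
    square is strictly convex, so maximality forces [P = Q = p], which is the
    equation.  When [p y] is 1 or -1 one of the twists vanishes. *)
Lemma extremal_cosine p (D : set (X -> R)) :
  (forall q, D q -> I (fun x => q x ^+ 2) <= I (fun x => p x ^+ 2)) ->
  pos_def p -> p 0 = 1 ->
  (forall t P Q, 0 < t -> t < 1 -> pos_def P -> P 0 = 1 -> pos_def Q -> Q 0 = 1 ->
     (forall x, p x = t * P x + (1 - t) * Q x) -> D P /\ D Q) ->
  forall x y, p (x + y) + p (x - y) = 2 * p x * p y.
Proof.
move=> pmax pdp p01 face x y; have [cp ev _] := pdp.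
have pdP := pos_def_twist y pdp (expr1n _ 2).
have pdQ : pos_def (fun x => 2 * p x + -1 * (p (x + y) + p (x - y))).
  by apply: pos_def_twist => //; rewrite sqrrN expr1n.
have P0 : 2 * p 0 + 1 * (p (0 + y) + p (0 - y)) = 2 + 2 * p y.
  by rewrite add0r sub0r ev p01; ring.
have Q0 : 2 * p 0 + -1 * (p (0 + y) + p (0 - y)) = 2 - 2 * p y.
  by rewrite add0r sub0r ev p01; ring.
have := pos_def_norm_le y pdp; rewrite p01 ler_norml => /andP[pyl pyr].
have [py|py] := eqVneq (p y) 1.
  have := pos_def_norm_le x pdQ; rewrite Q0 py ler_norml => /andP[? ?].
  lra.
have [py'|py'] := eqVneq (p y) (-1).
  have := pos_def_norm_le x pdP; rewrite P0 py' ler_norml => /andP[? ?].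
  lra.
have pl : -1 < p y by rewrite lt_neqAle eq_sym py' pyl.
have pr : p y < 1 by rewrite lt_neqAle py pyr.
pose t := (1 + p y) / 2.
have t0 : 0 < t by rewrite /t; lra.
have t1 : t < 1 by rewrite /t; lra.
pose P x := (4 * t)^-1 * (2 * p x + 1 * (p (x + y) + p (x - y))).
pose Q x := (4 * (1 - t))^-1 * (2 * p x + -1 * (p (x + y) + p (x - y))).
have pdP' : pos_def P by apply: pos_def_scale => //; rewrite invr_ge0; lra.
have pdQ' : pos_def Q by apply: pos_def_scale => //; rewrite invr_ge0; lra.
have P0' : P 0 = 1 by rewrite /P P0 /t; field; lra.
have Q0' : Q 0 = 1 by rewrite /Q Q0 /t; field; lra.
have pE z : p z = t * P z + (1 - t) * Q z.
  by rewrite /P /Q /t; field; apply/andP; split; lra.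
have [DP DQ] := face _ _ _ t0 t1 pdP' P0' pdQ' Q0' pE.
have [cP cQ] := (pos_def_cont pdP', pos_def_cont pdQ').
have sq (f : X -> R) : continuous f -> continuous (fun x => f x ^+ 2).
  by move=> cf; apply: (cont_mul cf cf).
have cPQ : continuous (fun x => (P x - Q x) ^+ 2) by apply: sq; cont.
have IE : I (fun x => p x ^+ 2) = t * I (fun x => P x ^+ 2)
    + (1 - t) * I (fun x => Q x ^+ 2) - t * (1 - t) * I (fun x => (P x - Q x) ^+ 2).
  have [sP sQ] := (sq _ cP, sq _ cQ).
  rewrite -!(meanZ mI) // -(meanD mI) -?(meanB mI); try by cont.
  by congr I; apply/funext => z; rewrite pE; ring.
have I0 : 0 <= I (fun x => (P x - Q x) ^+ 2).
  by apply: (mean_ge0 mI) => // z; exact: sqr_ge0.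
have PQ0 : I (fun x => (P x - Q x) ^+ 2) = 0.
  have := pmax _ DP; have := pmax _ DQ => mQ mP.
  have tt : 0 < t * (1 - t) by rewrite mulr_gt0 // subr_gt0.
  apply/eqP; rewrite eq_le I0 andbT -(ler_pM2l tt) mulr0.
  have : t * I (fun x => P x ^+ 2) <= t * I (fun x => p x ^+ 2) by rewrite ler_pM2l.
  have : (1 - t) * I (fun x => Q x ^+ 2) <= (1 - t) * I (fun x => p x ^+ 2).
    by rewrite ler_pM2l // subr_gt0.
  by move: IE; lra.
have /eqP := mean_eq0 compX mI cPQ (fun z => sqr_ge0 _) PQ0 x.
rewrite sqrf_eq0 subr_eq0 => /eqP PQ.
have Pp : P x = p x by rewrite (pE x) -PQ; ring.
have : (2 * p x + 1 * (p (x + y) + p (x - y))) = 4 * t * p x.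
  by rewrite -[in RHS]Pp /P mulVKf //; lra.
by rewrite /t; lra.
Qed.

(** The kernel is [h = p0 - I p0] with [p0] the autocorrelation of a nonconstant
    [g]; subtracting the mean gives [F 1 = 0], while [F p0] is the variance of [p0].
    First [F] is maximized, then the mean square among the maximizers of [F]. *)
Lemma exists_cosine (x1 : X) : hausdorff_space X -> x1 != 0 ->
  exists c : X -> R, [/\ continuous c, c 0 = 1, forall x, `|c x| <= 1,
    forall x y, c (x + y) + c (x - y) = 2 * c x * c y & exists a, c a != 1].
Proof.
move=> hausX x1n0.
have [g [cg _ g0 g1]] : exists g : X -> R, [/\ continuous g,
    range g `<=` `[0, 1], g @` [set 0] `<=` [set 0] & g @` [set x1] `<=` [set 1]].
  apply/uniform_separatorP; apply: normal_uniform_separator.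
  - exact: compact_normal.
  - exact/accessible_closed_set1/hausdorff_accessible.
  - exact/accessible_closed_set1/hausdorff_accessible.
  - by apply/seteqP; split => // x [-> /= e]; rewrite -e eqxx in x1n0.
have {}g0 : g 0 = 0 by apply: g0; exists 0.
have {}g1 : g x1 = 1 by apply: g1; exists x1.
pose p0 := corr I g g; have pd0 : pos_def p0 by exact: corr_pos_def.
have [cp0 _ _] := pd0.
have sq (f : X -> R) : continuous f -> continuous (fun x => f x ^+ 2).
  by move=> cf; apply: (cont_mul cf cf).
(* Equality would make the mean square of [g (x1 + x) - g x] vanish. *)
have p0nc : p0 x1 != p0 0.
  apply/eqP => e.
  have c2 : continuous (fun x => (g (x1 + x) - g x) ^+ 2) by apply: sq; cont.
  have I0 : I (fun x => (g (x1 + x) - g x) ^+ 2) = 0.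
    transitivity (I (fun x => g (x + x1) ^+ 2) + I (fun x => g x ^+ 2) - 2 * p0 x1).
      have s1 := sq _ cg; have s2 : continuous (fun x => g (x + x1) ^+ 2) by apply: sq; cont.
      rewrite /p0 /corr -(meanZ mI) -?(meanD mI) -?(meanB mI); try by cont.
      by congr I; apply/funext => x; rewrite [x + x1]addrC; ring.
    rewrite (mean_shift mI x1 (sq _ cg)) e /p0 /corr.
    by under [X in _ - _ * I X]eq_fun do rewrite add0r -expr2; ring.
  have /eqP := mean_eq0 compX mI c2 (fun x => sqr_ge0 _) I0 0.
  by rewrite sqrf_eq0 addr0 g0 g1 subr0 oner_eq0.
pose m := I p0; pose h x := p0 x - m.
have ch : continuous h by rewrite /h; cont.
pose F p := I (fun x => h x * p x).
have F1 : F (fun=> 1) = 0.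
  by rewrite /F; under eq_fun do rewrite mulr1; rewrite (meanB mI) ?mean_const ?subrr //; cont.
have Fp0 : 0 < F p0.
  have e : F p0 = I (fun x => h x ^+ 2).
    transitivity (F p0 - m * F (fun=> 1)); first by rewrite F1; ring.
    rewrite /F -(meanZ mI) -?(meanB mI); try by cont.
    by congr I; apply/funext => x; rewrite /h; ring.
  rewrite e lt_neqAle (mean_ge0 mI (sq _ ch)) ?andbT; last by move=> x; exact: sqr_ge0.
  rewrite eq_sym; apply: contra p0nc => /eqP I0.
  have h0 x : p0 x = m.
    have /eqP := mean_eq0 compX mI (sq _ ch) (fun x => sqr_ge0 _) I0 x.
    by rewrite sqrf_eq0 subr_eq0 => /eqP.
  by rewrite !h0.
have p00 : 0 < p0 0.
  rewrite ltNge; apply: contraL Fp0 => p00.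
  have z x : p0 x = 0.
    by apply/eqP; rewrite -normr_le0; apply: le_trans p00; exact: pos_def_norm_le.
  rewrite /F; under eq_fun do rewrite z mulr0.
  by rewrite (mean_const mI) ltxx.
have [M M0 hM] := cont_bounded compX ch.
pose D1 := [set p : X -> R | pos_def p /\ p 0 = 1].
have D1c p : D1 p -> continuous p by move=> [[]].
have D11 p : D1 p -> forall x, `|p x| <= 1.
  by move=> [pdp p1] x; rewrite -p1; exact: pos_def_norm_le.
have Flip p q e : continuous p -> continuous q -> (forall x, `|p x| <= 1) ->
   (forall x, `|q x| <= 1) -> (forall x, `|p x - q x| <= e) -> `|F p - F q| <= M * e.
  move=> cp cq _ _ pq; apply: (mean_dist_le mI); try by cont.
  by move=> x; rewrite -mulrBr normrM; apply: ler_pM.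
have FM p : D1 p -> F p <= M.
  move=> Dp; apply: le_trans (ler_norm _) _; apply: (mean_norm_le mI).
    by apply: cont_mul => //; exact: D1c.
  by move=> x; rewrite normrM -[M]mulr1; apply: ler_pM => //; exact: D11.
(* The normalization of [p0] shows that the supremum [r] is positive. *)
pose p0' x := (p0 0)^-1 * p0 x.
have Dp0' : D1 p0'.
  by split; [apply: pos_def_scale => //; rewrite invr_ge0 ltW|rewrite /p0' mulVf // lt0r_neq0].
have FZ a p : continuous p -> F (fun x => a * p x) = a * F p.
  move=> cp; rewrite /F -(meanZ mI); last by cont.
  by congr I; apply/funext => x; rewrite mulrCA.
pose r := sup (F @` D1).
have supF : has_sup (F @` D1).
  by split; [exists (F p0'), p0'|exists M => _ [p Dp <-]; exact: FM].
have Fr p : D1 p -> F p <= r.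
  by move=> Dp; apply: sup_upper_bound => //; exists p.
have r0 : 0 < r.
  by apply: lt_le_trans (Fr _ Dp0'); rewrite FZ // mulr_gt0 // invr_gt0.
have Fle q : pos_def q -> F q <= r * q 0.
  move=> pdq; have cq := pos_def_cont pdq.
  have q0 : 0 <= q 0 by apply: le_trans (pos_def_norm_le 0 pdq).
  have [q00|q00] := eqVneq (q 0) 0.
    have z x : q x = 0.
      by apply/eqP; rewrite -normr_le0 -q00; exact: pos_def_norm_le.
    by rewrite q00 mulr0 /F; under eq_fun do rewrite z mulr0; rewrite (mean_const mI).
  rewrite -ler_pdivrMr ?lt_neqAle 1?eq_sym ?q00 // mulrC -FZ //; apply: Fr; split.
    by apply: pos_def_scale => //; rewrite invr_ge0.
  by rewrite mulVf.
have Dcl (pn : nat -> X -> R) : (forall n, D1 (pn n)) ->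
    (forall e, 0 < e -> exists N : nat, forall n, (N <= n)%N -> r - F (pn n) <= e) ->
    exists p, D1 p /\ forall e N, 0 < e ->
       exists2 n, (N <= n)%N & forall x, `|p x - pn n x| <= e.
  move=> pnD /(extremal_cluster compX mI ch r0 Fle pnD)[p [pdp p1 pP]].
  by exists p.
have [p1 Dp1 p1max] : exists2 p, D1 p & forall q, D1 q -> F q <= F p.
  apply: (@sup_attained D1 F M M); rewrite -/r //; first by exists p0'.
  move=> pn /Dcl pnD /pnD[p [Dp pP]]; exists p; split=> //.
  by split; [exact: D1c|exact: D11|].
have Fp1 : F p1 = r.
  apply/eqP; rewrite eq_le Fr //=; apply: ge_sup; first by exists (F p0'), p0'.
  by move=> _ [q Dq <-]; exact: p1max.
pose D2 := [set p | D1 p /\ F p = r].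
pose N (p : X -> R) := I (fun x => p x ^+ 2).
have Nlip p q e : continuous p -> continuous q -> (forall x, `|p x| <= 1) ->
   (forall x, `|q x| <= 1) -> (forall x, `|p x - q x| <= e) -> `|N p - N q| <= 2 * e.
  move=> cp cq p_1 q_1 pq; apply: (mean_dist_le mI); try exact: sq.
  move=> x; rewrite subr_sqr normrM mulrC; apply: ler_pM => //.
  by apply: le_trans (ler_normD _ _) _; have := p_1 x; have := q_1 x; lra.
have [p Dp pmax] : exists2 p, D2 p & forall q, D2 q -> N q <= N p.
  apply: (@sup_attained D2 N 2 1) => //.
  - by exists p1.
  - by move=> p [/D1c].
  - move=> p [Dp _]; apply: le_trans (ler_norm _) _; apply: (mean_norm_le mI).
      by apply: sq; exact: D1c.
    by move=> x; rewrite normrX expr_le1 //; exact: D11.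
  - by move=> p [/D11].
  move=> pn pnD _; have [|e e0|p [Dp pP]] := Dcl pn.
  - by move=> n; exact: (pnD n).1.
  - by exists 0%N => n _; rewrite (pnD n).2 subrr ltW.
  exists p; split; first by split; [exact: D1c|exact: D11|].
  split=> //; apply/eqP; rewrite -subr_eq0 -normr_le0; apply/ler_addgt0Pr => e e0.
  have eM : 0 < e / M by rewrite divr_gt0.
  have [n _ np] := pP _ 0%N eM; rewrite add0r.
  have Dn := (pnD n).1.
  have := Flip _ _ _ (D1c _ Dp) (D1c _ Dn) (D11 _ Dp) (D11 _ Dn) np.
  by rewrite (pnD n).2 mulrC divfK // lt0r_neq0.
have [[pdp p01] Fp] := Dp.
exists p; split=> //; [exact: pos_def_cont|exact: D11| |].
  apply: (@extremal_cosine p D2) => //.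
  move=> t P Q t0 t1 pdP P0 pdQ Q0 pE.
  have FE : F p = t * F P + (1 - t) * F Q.
    have [cP cQ] := (pos_def_cont pdP, pos_def_cont pdQ).
    rewrite -!FZ // /F -(meanD mI); try by cont.
    by congr I; apply/funext => x; rewrite pE mulrDr.
  have DP : D1 P by []. have DQ : D1 Q by [].
  have FPr := Fr _ DP; have FQr := Fr _ DQ.
  have t1' : 0 < 1 - t by rewrite subr_gt0.
  have tP : t * F P <= t * r by rewrite ler_pM2l.
  have tQ : (1 - t) * F Q <= (1 - t) * r by rewrite ler_pM2l.
  split; split=> //; apply/eqP; rewrite eq_le.
    by rewrite FPr -(ler_pM2l t0); lra.
  by rewrite FQr -(ler_pM2l t1'); lra.
apply/not_existsP => pc; move: r0; rewrite -Fp => /lt0r_neq0 /eqP; apply.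
rewrite -F1; congr F; apply/funext => x.
by apply/eqP; apply: contraT => /(pc x).
Qed.

End Cosine.

(** * From a cosine to a character *)

Record character (R : realType) (X : topologicalZmodType) (c s : X -> R) : Prop :=
 Character {
  char_cos_cont : continuous c;
  char_sin_cont : continuous s;
  char_norm : forall x, c x ^+ 2 + s x ^+ 2 = 1;
  char_cosD : forall x y, c (x + y) = c x * c y - s x * s y;
  char_sinD : forall x y, s (x + y) = s x * c y + c x * s y }.

Section Character.
Variables (R : realType) (X : topologicalZmodType) (c : X -> R).
Hypotheses (connX : connected [set: X]) (cc : continuous c) (c0 : c 0 = 1).
Hypothesis dAlembert : forall x y, c (x + y) + c (x - y) = 2 * c x * c y.

Lemma cosine_even x : c (- x) = c x.
Proof. by have := dAlembert 0 x; rewrite c0 add0r sub0r; lra. Qed.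

(** The sine is found by polarization at a point [a] with [c a ^ 2 < 1]:
    [c (x + a) = c x c a - sig s x] with [sig = sin a].  Such an [a] exists because a
    continuous function with values 1 and -1 on a connected group is constant. *)
Lemma cosine_character : (forall x, `|c x| <= 1) -> (exists a, c a != 1) ->
  exists s, character c s.
Proof.
move=> c1 [a0 a0P].
have [a a1] : exists a, c a ^+ 2 != 1.
  apply/not_existsP => cpm.
  have {}cpm x : c x = 1 \/ c x = -1.
    have /negP := cpm x; rewrite negbK => /eqP/eqP; rewrite sqrf_eq1.
    by move=> /orP[/eqP|/eqP]; [left|right].
  have : is_interval (c @` [set: X]).
    apply/connected_intervalP; apply: connected_continuous_connected => //.
    exact: continuous_subspaceT.
  have ca0 : c a0 = -1 by have [/eqP|//] := cpm a0; rewrite (negbTE a0P).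
  move=> /(_ (-1) 1 _ _ 0)[||//|x _ cx].
  - by exists a0.
  - by exists 0.
  - by rewrite lerN10 ler01.
  - by have [] := cpm x; rewrite cx; lra.
have sg : 0 < 1 - c a ^+ 2.
  rewrite subr_gt0 lt_neqAle a1 /=.
  by have := c1 a; rewrite ler_norml => /andP[]; nra.
pose sig := Num.sqrt (1 - c a ^+ 2).
have sig0 : 0 < sig by rewrite sqrtr_gt0.
have sig2 : sig ^+ 2 = 1 - c a ^+ 2 by rewrite sqr_sqrtr // ltW.
pose s x := (c (x - a) - c (x + a)) / (2 * sig).
have caD x : c (x + a) = c x * c a - sig * s x.
  rewrite /s; have := dAlembert x a => e.
  have -> : sig * ((c (x - a) - c (x + a)) / (2 * sig)) = (c (x - a) - c (x + a)) / 2.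
    by field; rewrite lt0r_neq0.
  by lra.
have sdA x y : s (x + y) + s (x - y) = 2 * s x * c y.
  have e1 := dAlembert (x - a) y; have e2 := dAlembert (x + a) y.
  rewrite /s -mulrDl [X in X * c y]mulrA [RHS]mulrAC; congr (_ / _).
  have -> : x + y - a = x - a + y by rewrite addrAC.
  have -> : x + y + a = x + a + y by rewrite addrAC.
  have -> : x - y - a = x - a - y by rewrite addrAC.
  have -> : x - y + a = x + a - y by rewrite addrAC.
  by lra.
have s_odd x : s (- x) = - s x.
  rewrite /s -mulNr opprB; congr (_ / _).
  by rewrite -(cosine_even (- x - a)) -(cosine_even (- x + a)) !opprD !opprK.
have sD x y : s (x + y) = s x * c y + c x * s y.
  have := sdA x y; have := sdA y x; rewrite [y + x]addrC -(opprB x y) s_odd.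
  by lra.
have s_a : s a = sig.
  rewrite /s subrr c0; have := dAlembert a a; rewrite subrr c0 => e.
  have -> : 1 - c (a + a) = 2 * sig ^+ 2 by rewrite sig2; lra.
  by field; rewrite lt0r_neq0.
have cD x y : c (x + y) = c x * c y - s x * s y.
  have e1 z : sig * c z = s (z + a) - s z * c a by rewrite sD s_a; ring.
  apply: (mulfI (lt0r_neq0 sig0)).
  have -> : sig * c (x + y) = s (x + a + y) - s (x + y) * c a.
    by rewrite e1 addrAC.
  rewrite (sD (x + a)) (sD x a) (sD x y) caD s_a; ring.
exists s; split=> //.
- rewrite /s; under eq_fun do rewrite mulrC; cont.
- move=> x; have := cD x (- x); rewrite subrr c0 s_odd cosine_even => ->; ring.
Qed.

End Character.

Section CharacterTheory.
Variables (R : realType) (X : topologicalZmodType) (c s : X -> R).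
Hypothesis cs : character c s.

(** At 0 the pair is an idempotent of the circle group; the algebra excludes
    [c 0 = 1/2]. *)
Lemma char_cos0 : c 0 = 1.
Proof.
have [_ _ nrm cD sD] := cs.
have := cD 0 0; have := sD 0 0; have := nrm 0; rewrite addr0.
move=> n1 s1 c1; have s0 : s 0 * (1 - 2 * c 0) = 0 by rewrite mulrBr mulr1; lra.
move/eqP: s0; rewrite mulf_eq0 => /orP[/eqP s0|/eqP h].
  have c2 : c 0 * (1 - c 0) = 0 by rewrite s0 in c1; lra.
  move/eqP: c2; rewrite mulf_eq0 => /orP[/eqP c0|/eqP]; last by lra.
  by move: n1; rewrite c0 s0; lra.
have ch : c 0 = 1 / 2 by lra.
by move: n1 c1; rewrite ch; lra.
Qed.

Lemma char_sin0 : s 0 = 0.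
Proof.
have := char_norm cs 0; rewrite char_cos0 => e; apply/eqP.
by rewrite -sqrf_eq0; apply/eqP; lra.
Qed.

Lemma char_sin_eq0 x : c x = 1 -> s x = 0.
Proof.
move=> cx; have := char_norm cs x; rewrite cx => e; apply/eqP.
by rewrite -sqrf_eq0; apply/eqP; lra.
Qed.

(** Solve the addition formulas for [x] and [- x], whose determinant is [char_norm]. *)
Lemma char_cosN x : c (- x) = c x.
Proof.
have [_ _ nrm cD sD] := cs.
have := cD x (- x); have := sD x (- x); rewrite subrr char_cos0 char_sin0.
have := nrm x => n1 e1 e2.
have : c (- x) * (c x ^+ 2 + s x ^+ 2) = c x.
  transitivity (c x * (c x * c (- x) - s x * s (- x)) +
    s x * (s x * c (- x) + c x * s (- x))); first by ring.
  by rewrite -e1 -e2; ring.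
by rewrite n1 mulr1.
Qed.

Lemma char_sinN x : s (- x) = - s x.
Proof.
have [_ _ nrm cD sD] := cs.
have := cD x (- x); have := sD x (- x); rewrite subrr char_cos0 char_sin0.
have := nrm x => n1 e1 e2.
have : s (- x) * (c x ^+ 2 + s x ^+ 2) = - s x.
  transitivity (- s x * (c x * c (- x) - s x * s (- x)) +
    c x * (s x * c (- x) + c x * s (- x))); first by ring.
  by rewrite -e1 -e2; ring.
by rewrite n1 mulr1.
Qed.

Lemma char_cosB x y : c (x - y) = c x * c y + s x * s y.
Proof. by rewrite (char_cosD cs) char_cosN char_sinN; ring. Qed.

Lemma char_norm_le x : `|c x| <= 1.
Proof. by have := char_norm cs x; rewrite ler_norml => e; apply/andP; split; nra. Qed.

(** A unit vector with cosine 1 is the neutral element of the circle. *)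
Lemma char_kerB x y : c x = 1 -> c y = 1 -> c (x - y) = 1.
Proof.
by move=> cx cy; rewrite char_cosB cx cy (char_sin_eq0 cx) (char_sin_eq0 cy); ring.
Qed.

Lemma char_ker_eq x y : c (x - y) = 1 -> c x = c y.
Proof.
move=> cxy; rewrite -(subrK y x) (char_cosD cs) cxy (char_sin_eq0 cxy); ring.
Qed.

End CharacterTheory.

(** * The action of integer polynomials *)

(** In a finite Hausdorff space points are open. *)
Lemma connected_finite (T : topologicalType) (A : set T) (x : T) :
  hausdorff_space T -> connected A -> finite_set A -> A x -> A = [set x].
Proof.
move=> hT cA fA Ax; apply/esym; apply: cA; first by exists x.
- exists (~` (A `\ x)).
    apply: closed_openC; apply: (accessible_finite_set_closed.1 _ _ (finite_setD _ fA)).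
    exact: hausdorff_accessible.
  apply/seteqP; split=> [_ ->|y [Ay /=]]; first by split=> // -[_]; apply.
  by move=> nA; apply: contrapT => yx; apply: nA; split.
- exists [set x]; first exact/accessible_closed_set1/hausdorff_accessible.
  by apply/seteqP; split=> [_ ->|y [_ ->]].
Qed.

Section PolyAction.
Variables (X : topologicalZmodType) (alpha : topAut X).
Implicit Types (f g : {poly int}) (x y : X).

(** The action of [Z[t]] on [X] with [t] acting as [alpha]. *)
Definition poly_act f x := \sum_(i < size f) iter i alpha x *~ f`_i.

Lemma poly_actE N f x : (size f <= N)%N ->
  poly_act f x = \sum_(i < N) iter i alpha x *~ f`_i.
Proof.
move=> fN; rewrite /poly_act (big_ord_widen N (fun i => iter i alpha x *~ f`_i)) //.
rewrite big_mkcond; apply: eq_bigr => i _.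
by case: ltnP => // fi; rewrite nth_default // mulr0z.
Qed.

Lemma poly_actD f g x : poly_act (f + g) x = poly_act f x + poly_act g x.
Proof.
pose N := maxn (size f) (size g).
rewrite !(@poly_actE N) ?leq_maxl ?leq_maxr ?size_polyD // -big_split.
by apply: eq_bigr => i _; rewrite coefD mulrzDr.
Qed.

Lemma poly_actC k x : poly_act k%:P x = x *~ k.
Proof.
by rewrite (@poly_actE 1) ?size_polyC ?leq_b1 // big_ord1 coefC.
Qed.

Lemma poly_actMX f x : poly_act (f * 'X) x = poly_act f (alpha x).
Proof.
rewrite (@poly_actE (size f).+1); last first.
  by apply: leq_trans (size_polyMleq _ _) _; rewrite size_polyX addn2.
rewrite big_ord_recl coefMX eqxx mulr0z add0r; apply: eq_bigr => i _.
by rewrite coefMX /= -iterS iterSr.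
Qed.

Lemma aut_iter_natB n x y : iter n alpha (x - y) = iter n alpha x - iter n alpha y.
Proof. by elim: n => //= n ->; rewrite raddfB. Qed.

Lemma poly_actB f x y : poly_act f (x - y) = poly_act f x - poly_act f y.
Proof.
rewrite /poly_act -sumrB; apply: eq_bigr => i _.
by rewrite aut_iter_natB mulrzBl.
Qed.

Lemma poly_act0 f : poly_act f 0 = 0.
Proof. by rewrite -[X in poly_act f X](subrr 0) poly_actB subrr. Qed.

Lemma poly_actDx f x y : poly_act f (x + y) = poly_act f x + poly_act f y.
Proof.
by rewrite -[in LHS](opprK y) poly_actB -(sub0r y) poly_actB poly_act0 sub0r opprK.
Qed.

Lemma poly_act_aut f x : poly_act f (alpha x) = alpha (poly_act f x).
Proof.
rewrite /poly_act raddf_sum; apply: eq_bigr => i _.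
by rewrite raddfMz -iterS iterSr.
Qed.

Lemma poly_actZ k f x : poly_act (k *: f) x = poly_act f x *~ k.
Proof.
rewrite (@poly_actE (size f)) ?size_scale_leq // /poly_act mulrz_suml.
by apply: eq_bigr => i _; rewrite coefZ mulrC mulrzA.
Qed.

Lemma poly_actM f g x : poly_act (f * g) x = poly_act f (poly_act g x).
Proof.
elim/poly_ind: f x => [|f k IH] x.
  by rewrite mul0r /poly_act size_poly0 !big_ord0.
rewrite mulrDl !poly_actD poly_actMX poly_actC -mulrA ['X * g]mulrC mulrA poly_actMX IH.
by rewrite poly_act_aut mul_polyC poly_actZ.
Qed.

Lemma poly_act_cont f : continuous (poly_act f).
Proof.
rewrite /poly_act; elim: (size f) => [|n IH] x.
  by under eq_fun do rewrite big_ord0; apply: cvg_cst.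
rewrite /continuous_at big_ord_recr /=; under eq_fun do rewrite big_ord_recr /=.
apply: cvg_add_group; first exact: IH.
apply: cont_mulrz => {}x; elim: n {IH} => [|n IH] /=; first exact: cvg_id.
apply: continuous_comp; [exact: IH|exact: aut_fun_continuous].
Qed.

End PolyAction.

(** * Closed invariant subgroups of an irreducible system *)

Section Irreducible.
Variables (X : topologicalZmodType) (alpha : topAut X).
Hypotheses (hausX : hausdorff_space X) (compX : compact [set: X]).
Hypotheses (connX : connected [set: X]) (irr : irreducible_aut alpha).
Implicit Types (f g : {poly int}).
Local Notation act := (poly_act alpha).

(** The form of irreducibility used below: a witness outside [H] replaces
    [H <> setT]. *)
Lemma proper_invariant_finite (H : set X) a : closed H -> subgroup_set H ->
  (forall x, H (alpha x) <-> H x) -> ~ H a -> finite_set H.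
Proof.
move=> cH sH iH nHa; apply: irr => //; last by move=> HT; apply: nHa; rewrite HT.
apply/seteqP; split=> [_ [x Hx <-]|x Hx]; first exact/iH.
by exists (aut_inv alpha x); rewrite ?aut_invK //; apply/iH; rewrite aut_invK.
Qed.

(** The image is a compact invariant subgroup; if it were proper it would be finite
    and connected, hence 0. *)
Lemma poly_act_surj f a : act f a <> 0 -> forall y, exists x, act f x = y.
Proof.
move=> fa y; pose H := act f @` [set: X].
have [HT|HT] := pselect (H = [set: X]).
  by have : H y by [rewrite HT]; move=> [x _ <-]; exists x.
suff fH : finite_set H.
  have H0 : H = [set 0].
    apply: connected_finite => //; last by exists 0 => //; exact: poly_act0.
    apply: connected_continuous_connected => //.
    apply: continuous_subspaceT; exact: poly_act_cont.
  by exfalso; apply: fa; have : H (act f a) by [exists a]; rewrite H0.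
apply: irr => //.
- apply: compact_closed => //; apply: continuous_compact => //.
  apply: continuous_subspaceT; exact: poly_act_cont.
- split; first by exists 0 => //; exact: poly_act0.
  by move=> _ _ [x _ <-] [x' _ <-]; exists (x - x') => //; exact: poly_actB.
apply/seteqP; split=> [_ [_ [x _ <-] <-]|_ [x _ <-]].
  by exists (alpha x) => //; exact: poly_act_aut.
exists (act f (aut_inv alpha x)); first by exists (aut_inv alpha x).
by rewrite -poly_act_aut aut_invK.
Qed.

Lemma closed_fiber (T : topologicalType) (h : X -> T) b : hausdorff_space T ->
  continuous h -> closed [set x | h x = b].
Proof.
move=> hT ch; apply: (@preimage_closed _ _ h [set b]).
  by move=> x _; exact: ch.
exact/accessible_closed_set1/hausdorff_accessible.
Qed.

Lemma poly_act_ker_finite f a : act f a <> 0 -> finite_set [set x | act f x = 0].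
Proof.
move=> fa; apply: (@proper_invariant_finite _ a) => //.
- by apply: closed_fiber => //; exact: poly_act_cont.
- split=> [|x y /= fx fy]; first exact: poly_act0.
  by rewrite poly_actB fx fy subr0.
move=> x /=; rewrite poly_act_aut; split=> [e|->]; last by rewrite raddf0.
by apply: (can_inj (aut_funK alpha)); rewrite e raddf0.
Qed.

(** The annihilator of [X] in [Z[t]] is a prime ideal, since the other elements act
    surjectively. *)
Lemma poly_act_prime f g a : act (f * g) =1 (fun=> 0) -> act g a <> 0 ->
  act f =1 (fun=> 0).
Proof.
by move=> fg0 /poly_act_surj gs y; have [x <-] := gs y; rewrite -poly_actM fg0.
Qed.

(** Isolate 0 in the finite set: far iterates of [z] must equal 0. *)
Lemma homoclinic_in_finite_eq0 (H : set X) z : finite_set H ->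
  (forall n : int, H (aut_iter alpha n z)) -> homoclinic alpha z -> z = 0.
Proof.
move=> fH Hz hz.
have [|N NP] := hz (~` (H `\ 0)).
  apply: open_nbhs_nbhs; split; last by move=> [_]; apply.
  apply: closed_openC; apply: (accessible_finite_set_closed.1 _ _ (finite_setD _ fH)).
  exact: hausdorff_accessible.
have := NP N%:Z (leqnn _); have := Hz N%:Z; set w := aut_iter _ _ _ => Hw nw.
have : w = 0 by apply: contrapT => w0; apply: nw; split.
rewrite /w /= => {w Hw nw}; elim: N {NP} => //= N IH e; apply: IH.
by apply: (can_inj (aut_funK alpha)); rewrite e raddf0.
Qed.

Section WithCharacter.
Variables (R : realType) (c s : X -> R).
Hypotheses (cs : character c s) (cn1 : exists a, c a != 1).

(** The annihilator of the orbit of the character under the dual of [alpha]. *)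
Definition orbit_kernel := [set x | forall n : int, c (aut_iter alpha n x) = 1].

Lemma orbit_kernel_closed (h : X -> X) : continuous h ->
  closed [set x | orbit_kernel (h x)].
Proof.
move=> ch; rewrite (_ : [set x | _] =
    \bigcap_(n : int) [set x | c (aut_iter alpha n (h x)) = 1]).
  apply: closed_bigI => n _; apply: closed_fiber; first exact: Rhausdorff.
  exact: (cont_comp ch (cont_comp (@aut_iter_cont _ alpha n) (char_cos_cont cs))).
by apply/seteqP; split=> [x Kx n _|x Kx n]; [exact: Kx|exact: Kx].
Qed.

Lemma orbit_kernelB x y : orbit_kernel x -> orbit_kernel y -> orbit_kernel (x - y).
Proof. by move=> Kx Ky n; rewrite aut_iterB; exact: (char_kerB cs). Qed.

Lemma orbit_kernel_aut x : orbit_kernel (alpha x) <-> orbit_kernel x.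
Proof.
split=> Kx n; last by rewrite aut_iter_aut; exact: Kx.
by rewrite -(subrK 1 n) -aut_iter_aut; exact: Kx.
Qed.

Lemma orbit_kernel0 : orbit_kernel 0.
Proof. by move=> n; rewrite aut_iter0; exact: char_cos0 cs. Qed.

Lemma orbit_kernel_finite : finite_set orbit_kernel.
Proof.
have [a ca] := cn1; apply: (@proper_invariant_finite _ a).
- exact: (@orbit_kernel_closed id (fun=> cvg_id)).
- by split; [exact: orbit_kernel0|exact: orbit_kernelB].
- exact: orbit_kernel_aut.
- by move=> /(_ 0) /=; apply/eqP.
Qed.

End WithCharacter.
End Irreducible.

(** * Two growth estimates *)

(** The ratio of consecutive terms on the right is [(2m + 1) / (2m + 2)]. *)
Lemma central_bin_ge (R : realFieldType) (m : nat) :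
  (2 * m).+1%:R^-1 <= 'C(2 * m, m)%:R / 4 ^+ m :> R.
Proof.
elim: m => [|m IH]; first by rewrite muln0 bin0 expr0 invr1 mulr1.
have e1 : (m.+1 * 'C(2 * m.+1, m.+1) = 2 * (2 * m).+1 * 'C(2 * m, m))%N.
  have -> : (2 * m.+1 = (2 * m).+2)%N by lia.
  have h1 := mul_bin_diag (2 * m).+2 m.
  have h2 := mul_bin_down (2 * m).+1 m.
  rewrite /= in h1 h2.
  have e : ((2 * m).+1 - m = m.+1)%N by lia.
  rewrite e in h2.
  have h3 : (m.+1 * (m.+1 * 'C((2 * m).+2, m.+1)) = m.+1 * (2 * (2 * m).+1 * 'C(2 * m, m)))%N.
    rewrite -h1 mulnCA -h2; lia.
  by move/eqP: h3; rewrite eqn_pmul2l // => /eqP.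
have e2 : m.+1%:R * 'C(2 * m.+1, m.+1)%:R = 2 * (2 * m).+1%:R * 'C(2 * m, m)%:R :> R.
  by rewrite -!natrM e1.
have m0 : 0 < m.+1%:R :> R by rewrite ltr0n.
have p0 : 0 < (2 * m).+1%:R :> R by rewrite ltr0n.
have -> : 'C(2 * m.+1, m.+1)%:R / 4 ^+ m.+1 =
    (2 * m).+1%:R / (2 * m.+1%:R) * ('C(2 * m, m)%:R / 4 ^+ m) :> R.
  have -> : 'C(2 * m.+1, m.+1)%:R = 2 * (2 * m).+1%:R * 'C(2 * m, m)%:R / m.+1%:R :> R.
    by rewrite -e2 mulrAC divff ?mul1r // lt0r_neq0.
  rewrite exprS; field.
  by rewrite expf_neq0 ?lt0r_neq0.
apply: (@le_trans _ _ ((2 * m).+1%:R / (2 * m.+1%:R) * (2 * m).+1%:R^-1)).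
  rewrite mulrAC divff ?lt0r_neq0 // mul1r lef_pV2 ?posrE ?mulr_gt0 //.
  by rewrite -natrM ler_nat; lia.
by rewrite ler_wpM2l // divr_ge0.
Qed.

(** Split [q = s ^ 2]: one factor [s ^ m] takes care of [D] powers by induction, the
    other of one more power by Bernoulli's inequality. *)
Lemma expr_poly_bounded (R : realType) (D : nat) (q : R) : 0 < q -> q < 1 ->
  exists2 B, 0 < B & forall m, q ^+ m * (2 * m).+1%:R ^+ D <= B.
Proof.
elim: D q => [|D IH] q q0 q1.
  by exists 1 => // m; rewrite expr0 mulr1 exprn_ile1 // ltW.
pose s := Num.sqrt q.
have s0 : 0 < s by rewrite sqrtr_gt0.
have s2 : s ^+ 2 = q by rewrite sqr_sqrtr // ltW.
have s1 : s < 1 by rewrite -(@ltr_pXn2r _ 2) ?nnegrE ?expr1n ?s2 // ltW.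
have [B B0 BP] := IH s s0 s1.
pose h := s^-1 - 1.
have h0 : 0 < h by rewrite subr_gt0 invf_gt1.
have bern m : 1 + m%:R * h <= s^-1 ^+ m.
  elim: m => [|m IHm]; first by rewrite mul0r addr0 expr0.
  have hh : 0 <= m%:R * h * h by rewrite !mulr_ge0 // ltW.
  apply: (@le_trans _ _ (s^-1 * (1 + m%:R * h))).
    have -> : s^-1 = h + 1 by rewrite subrK.
    rewrite -natr1; lra.
  by rewrite exprS ler_wpM2l // invr_ge0 ltW.
have lin m : s ^+ m * (2 * m).+1%:R <= 2 / h + 1.
  have p : 0 < s^-1 ^+ m by rewrite exprn_gt0 // invr_gt0.
  rewrite -(ler_pM2l p) mulrA -exprMn mulVf ?lt0r_neq0 // expr1n mul1r.
  have k0 : 0 <= 2 / h + 1 by rewrite addr_ge0 // divr_ge0 // ltW.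
  apply: (@le_trans _ _ ((1 + m%:R * h) * (2 / h + 1))); last by rewrite ler_wpM2r.
  have -> : (1 + m%:R * h) * (2 / h + 1) = 1 + 2 / h + m%:R * h + 2 * m%:R.
    by field; rewrite lt0r_neq0.
  have i0 : 0 <= 2 / h by rewrite divr_ge0 // ltW.
  have mh : 0 <= m%:R * h by rewrite mulr_ge0 // ltW.
  rewrite -natr1 natrM; lra.
exists (B * (2 / h + 1)).
  by rewrite mulr_gt0 // addr_gt0 // divr_gt0.
move=> m; have -> : q ^+ m * (2 * m).+1%:R ^+ D.+1 =
   s ^+ m * (2 * m).+1%:R ^+ D * (s ^+ m * (2 * m).+1%:R).
  by rewrite -s2 -exprM mulnC exprM expr2 exprS; ring.
apply: ler_pM => //; first by rewrite mulr_ge0 // exprn_ge0 // ltW.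
by rewrite mulr_ge0 // exprn_ge0 // ltW.
Qed.

Lemma expr_beats_poly (R : realType) (D : nat) (q : R) : 0 < q -> q < 1 ->
  exists m, q ^+ m * (2 * m).+1%:R ^+ D < 1.
Proof.
move=> q0 q1; have [B B0 BP] := @expr_poly_bounded R D.+1 q q0 q1.
pose m := (Num.truncn B).+1; exists m.
have Bm : B < (2 * m).+1%:R.
  apply: lt_le_trans (truncnS_gt _) _; rewrite ler_nat.
  by apply: leqW; rewrite mul2n -addnn leq_addr.
have p0 : 0 < (2 * m).+1%:R :> R by rewrite ltr0n.
rewrite -(ltr_pM2r p0) mul1r -mulrA -exprSr.
exact: le_lt_trans (BP m) Bm.
Qed.

(** * Independence of the translates of a character *)

Local Open Scope complex_scope.

Section Expansion.
Variables (R : realType) (X : topologicalZmodType) (c s : X -> R).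
Hypothesis cs : character c s.

(** The complex form of the character turns Fejer-type kernels into binomial sums. *)
Definition cchar (x : X) : R[i] := c x +i* s x.

Lemma ccharD x y : cchar (x + y) = cchar x * cchar y.
Proof.
by rewrite /cchar (char_cosD cs) (char_sinD cs); simpc; rewrite [s x * c y + _]addrC.
Qed.

Lemma cchar0 : cchar 0 = 1.
Proof. by rewrite /cchar (char_cos0 cs) (char_sin0 cs). Qed.

Lemma cchar_neq0 x : cchar x != 0.
Proof.
apply/eqP => e; have := ccharD x (- x).
by rewrite subrr cchar0 e mul0r => /eqP; rewrite oner_eq0.
Qed.

Lemma ccharN x : cchar (- x) = (cchar x)^-1.
Proof.
apply: (mulfI (cchar_neq0 x)); rewrite -ccharD subrr cchar0 divff //.
exact: cchar_neq0.
Qed.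

Lemma ccharMz x (n : int) : cchar (x *~ n) = cchar x ^ n.
Proof.
have nat_case (k : nat) : cchar (x *+ k) = cchar x ^+ k.
  elim: k => [|k IH]; first by rewrite mulr0n cchar0 expr0.
  by rewrite mulrS ccharD IH exprS.
case: n => k; first exact: nat_case.
by rewrite NegzE mulrNz ccharN -[x *~ _]/(x *+ k.+1) nat_case.
Qed.

Lemma cchar_sum (J : Type) (r : seq J) (t : J -> X) :
  cchar (\sum_(j <- r) t j) = \prod_(j <- r) cchar (t j).
Proof.
by elim: r => [|j r IH]; rewrite ?big_nil ?cchar0 // !big_cons ccharD IH.
Qed.

(** With [e = cchar x] of modulus 1, [(1 + c x) / 2 = (1 + e) ^ 2 / (4 e)]. *)
Lemma fejer_expansion (m : nat) x :
  (((1 + c x) / 2) ^+ m)%:C = 4 ^- m *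
     \sum_(j < (2 * m).+1) 'C(2 * m, j)%:R * cchar (x *~ (j%:Z - m%:Z)).
Proof.
have e0 := cchar_neq0 x.
have h : ((1 + c x) / 2)%:C = (1 + cchar x) ^+ 2 / (4 * cchar x).
  apply: (mulIf (_ : 4 * cchar x != 0)); first by rewrite mulf_neq0 // pnatr_eq0.
  rewrite divfK; last by rewrite mulf_neq0 // pnatr_eq0.
  have h2 : (1 + c x)%:C * 2 = ((1 + c x) / 2)%:C * 4.
    rewrite -(rmorph_nat (real_complex R) 2) -(rmorph_nat (real_complex R) 4).
    by rewrite -!rmorphM /=; congr (_ %:C); field.
  rewrite mulrA -h2 /cchar; have := char_norm cs x.
  rewrite expr2; simpc => n; apply/eqP; rewrite eq_complex /=.
  by apply/andP; split; apply/eqP; nra.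
rewrite rmorphXn /= h expr_div_n [(4 * _) ^+ m]exprMn invfM mulrCA -exprM; congr (_ * _).
rewrite exprDn mulr_suml; apply: eq_bigr => j _.
rewrite expr1n mul1r ccharMz expfzDr // -exprnN mulrnAl -mulr_natl.
by [].
Qed.

Lemma fejer_prod (D m : nat) (t : 'I_D -> X) :
  \prod_k ((1 + c (t k)) / 2) ^+ m = 4 ^- (m * D) *
   \sum_(f : {ffun 'I_D -> 'I_(2 * m).+1})
     (\prod_k 'C(2 * m, f k))%:R * c (\sum_k t k *~ ((f k)%:Z - m%:Z)).
Proof.
have key : (\prod_k ((1 + c (t k)) / 2) ^+ m)%:C = (4 ^- (m * D) : R)%:C *
   \sum_(f : {ffun 'I_D -> 'I_(2 * m).+1})
     ((\prod_k 'C(2 * m, f k))%:R : R)%:C *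
        cchar (\sum_k t k *~ ((f k)%:Z - m%:Z)).
  rewrite rmorph_prod /=; under eq_bigr do rewrite fejer_expansion.
  rewrite big_split /= prodr_const card_ord -exprVn -exprM.
  rewrite fmorphV rmorphXn /= -exprVn; congr (_ * _); first by rewrite rmorph_nat.
  rewrite bigA_distr_bigA /=; apply: eq_bigr => f _.
  by rewrite big_split /= cchar_sum rmorph_nat natr_prod.
have ReM (a : R) (z : R[i]) : complex.Re (a%:C * z) = a * complex.Re z.
  by case: z => u v /=; rewrite mul0r subr0.
have := congr1 (@complex.Re R) key; rewrite ReM /= => ->; congr (_ * _).
rewrite (big_morph (@complex.Re R) (id1 := 0) (op1 := +%R)) //; last first.
  by move=> [? ?] [? ?].
by apply: eq_bigr => f _; rewrite ReM.
Qed.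
End Expansion.

Section Kronecker.
Variables (R : realType) (X : topologicalZmodType) (alpha : topAut X).
Variables (c s : X -> R) (I : (X -> R) -> R).
Hypotheses (hausX : hausdorff_space X) (compX : compact [set: X]).
Hypotheses (connX : connected [set: X]) (irr : irreducible_aut alpha).
Hypotheses (mI : invariant_mean I).
Hypotheses (cs : character c s) (cn1 : exists a, c a != 1).
Local Notation act := (poly_act alpha).

Lemma mean_sum (J : Type) (r : seq J) (F : J -> X -> R) :
  (forall j, continuous (F j)) ->
  continuous (fun x => \sum_(j <- r) F j x) /\
  I (fun x => \sum_(j <- r) F j x) = \sum_(j <- r) I (F j).
Proof.
move=> cF; elim: r => [|j r [IH1 IH2]].
  by under eq_fun do rewrite big_nil; rewrite big_nil (mean_const mI); split=> //; cont.
under eq_fun do rewrite big_cons; rewrite big_cons (meanD mI) // IH2.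
by split=> //; cont.
Qed.

Lemma char_act_cont g y : continuous (fun x => c (act g x - y)).
Proof.
apply: (@cont_comp _ _ _ (act g) (fun z => c (z - y))).
  exact: poly_act_cont.
by apply: cont_shiftr; exact: char_cos_cont cs.
Qed.

(** Take [w] with [act g w = b] and [c b] different from 1.  Translating by [w] and by
    [- w] preserves the mean, but the two translates add up to [2 * c b] times the
    function. *)
Lemma mean_char0 g a y : act g a <> 0 -> I (fun x => c (act g x - y)) = 0.
Proof.
move=> /(poly_act_surj hausX compX connX irr) gs.
have [b cb] := cn1; have [w gw] := gs b.
have cf : continuous (fun x => c (act g x - y)) by exact: char_act_cont.
have cw v : continuous (fun x => c (act g (x + v) - y)).
  exact: (@cont_shiftr X R (fun x => c (act g x - y)) v).
have e1 := mean_shift mI w cf; have e2 := mean_shift mI (- w) cf.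
have : 2 * c b * I (fun x => c (act g x - y)) = 2 * I (fun x => c (act g x - y)).
  rewrite [RHS]mulr_natl mulr2n -[X in _ = X + _]e1 -[X in _ = _ + X]e2.
  rewrite -(meanD mI) //.
  rewrite -(meanZ mI) //; congr I; apply/funext => x.
  rewrite poly_actB poly_actDx gw ![_ + b - y]addrAC [_ - b - y]addrAC.
  by rewrite (char_cosB cs _ b) (char_cosD cs _ b); ring.
move/eqP; rewrite -subr_eq0 -mulrBl mulf_eq0 => /orP[|/eqP//].
by rewrite -[X in _ - X]mulr1 -mulrBr mulf_eq0 pnatr_eq0 /= subr_eq0 (negbTE cb).
Qed.

Hypothesis indep : forall f : {poly int}, f != 0 -> exists a, act f a <> 0.

(** If every [x] missed the target at some time [k < D], the kernel
    [\prod_k ((1 + c (alpha^k x - x0)) / 2) ^ m] would be at most [q ^ m] with [q < 1].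
    But it is a positive combination of translates of characters, of which only
    the constant ones have a nonzero mean, so its mean is at least the constant
    coefficient [('C(2m, m) / 4 ^ m) ^ D], which decays polynomially in [m]. *)
Lemma kronecker_orbit x0 (D : nat) (d : R) : 0 < d ->
  exists x, forall k, (k < D)%N -> 1 - d < c (iter k alpha x - x0).
Proof.
move=> d0; apply: contrapT => none.
pose q := 1 - Num.min d 1 / 2.
have [q0 q1] : 0 < q /\ q < 1.
  have : 0 < Num.min d 1 by rewrite lt_min d0 ltr01.
  have : Num.min d 1 <= 1 by rewrite ge_min lexx orbT.
  by rewrite /q; move: (Num.min d 1) => e; split; lra.
have bad x : exists k : 'I_D, (1 + c (iter k alpha x - x0)) / 2 <= q.
  apply: contrapT => nk; apply: none; exists x => k kD.
  rewrite ltNge; apply/negP => ck; apply: nk; exists (Ordinal kD) => /=.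
  have : Num.min d 1 <= d by rewrite ge_min lexx.
  by rewrite /q; move: (Num.min d 1) => e; lra.
have [m mP] := expr_beats_poly D q0 q1.
pose t x (k : 'I_D) := iter k alpha x - x0.
pose U x := \prod_(k < D) ((1 + c (t x k)) / 2) ^+ m.
(* The frequency vector of the term indexed by [f], extended by 0 to all
   naturals so that it can be the coefficient function of a polynomial. *)
pose j (f : {ffun 'I_D -> 'I_(2 * m).+1}) (k : nat) : int :=
  if insub k is Some k' then (f k')%:Z - m%:Z else 0.
pose g f := \poly_(k < D) j f k.
pose y (f : {ffun 'I_D -> 'I_(2 * m).+1}) := x0 *~ (\sum_(k < D) ((f k)%:Z - m%:Z)) : X.
have tE (f : {ffun 'I_D -> 'I_(2 * m).+1}) x : \sum_k t x k *~ ((f k)%:Z - m%:Z) = act (g f) x - y f.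
  rewrite (@poly_actE _ _ D) ?size_poly // /y mulrz_sumr -sumrB.
  by apply: eq_bigr => k _; rewrite coef_poly ltn_ord /j valK /t mulrzBl.
pose b (f : {ffun 'I_D -> 'I_(2 * m).+1}) : R := (\prod_k 'C(2 * m, f k))%:R.
have UE : U = fun x => 4 ^- (m * D) * \sum_f b f * c (act (g f) x - y f).
  apply/funext => x; rewrite /U (fejer_prod cs); congr (_ * _).
  by apply: eq_bigr => f _; rewrite tE.
have cF f : continuous (fun x => b f * c (act (g f) x - y f)).
  by apply: cont_mul; [exact: cont_const|exact: char_act_cont].
have cU : continuous U.
  by rewrite UE; apply: cont_mul; [exact: cont_const|exact: (mean_sum _ cF).1].
have IU : I U = 4 ^- (m * D) * \sum_f b f * I (fun x => c (act (g f) x - y f)).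
  rewrite UE (meanZ mI); last exact: (mean_sum _ cF).1.
  rewrite (mean_sum _ cF).2; congr (_ * _); apply: eq_bigr => f _.
  by rewrite (meanZ mI) //; exact: char_act_cont.
have I1 f : g f = 0 -> I (fun x => c (act (g f) x - y f)) = 1.
  move=> g0; rewrite -(mean_const mI 1); congr I; apply/funext => x.
  rewrite -tE big1 ?(char_cos0 cs) // => k _.
  have := coef_poly D (j f) k; rewrite -/(g f) g0 coef0 ltn_ord /j valK => <-.
  by rewrite mulr0z.
have Ige f : 0 <= I (fun x => c (act (g f) x - y f)).
  have [g0|/indep[a ga]] := eqVneq (g f) 0; first by rewrite I1.
  by rewrite (mean_char0 _ ga).
have mlt : (m < (2 * m).+1)%N by lia.
pose f0 : {ffun 'I_D -> 'I_(2 * m).+1} := [ffun=> Ordinal mlt].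
have g0 : g f0 = 0.
  apply/polyP => k; rewrite coef_poly coef0; case: ifP => // kD.
  by rewrite /j insubT /= ffunE /= subrr.
have low : ('C(2 * m, m)%:R / 4 ^+ m) ^+ D <= I U.
  rewrite IU (bigD1 f0) //= I1 // mulr1.
  have -> : ('C(2 * m, m)%:R / 4 ^+ m) ^+ D = 4 ^- (m * D) * b f0 :> R.
    rewrite /b natr_prod; under eq_bigr do rewrite ffunE.
    by rewrite prodr_const card_ord expr_div_n -exprM mulrC.
  rewrite ler_pM2l ?invr_gt0 ?exprn_gt0 // lerDl.
  by apply: sumr_ge0 => f _; apply: mulr_ge0 => //; exact: ler0n.
have u01 x k : 0 <= (1 + c (t x k)) / 2 <= 1.
  by have := char_norm_le cs (t x k); rewrite ler_norml => /andP[? ?]; apply/andP; split; lra.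
have high : I U <= q ^+ m.
  rewrite -[X in _ <= X](mean_const mI); apply: (mean_le mI) => //; first exact: cont_const.
  move=> x; have [k kq] := bad x.
  rewrite /U (bigD1 k) //= -[q ^+ m]mulr1; apply: ler_pM.
  - by rewrite exprn_ge0 //; have /andP[] := u01 x k.
  - by apply: prodr_ge0 => i _; rewrite exprn_ge0 //; have /andP[] := u01 x i.
  - have /andP[u0 _] := u01 x k.
    by apply: lerXn2r => //; rewrite nnegrE // ltW.
  apply: (@le_trans _ _ (\prod_(i < D | i != k) 1)); last by rewrite big1.
  apply: ler_prod => i _; have /andP[u0 u1] := u01 x i.
  by rewrite exprn_ge0 // exprn_ile1.
have p0 : 0 < (2 * m).+1%:R :> R by rewrite ltr0n.
have : (2 * m).+1%:R^-1 ^+ D <= q ^+ m.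
  apply: le_trans high; apply: le_trans low; apply: lerXn2r.
  - by rewrite nnegrE invr_ge0 ltW.
  - by rewrite nnegrE divr_ge0 // exprn_ge0.
  exact: central_bin_ge.
rewrite leNgt => /negP; apply.
by rewrite exprVn -ltr_pdivlMr ?invr_gt0 ?exprn_gt0 // ?invrK ?div1r in mP *.
Qed.

End Kronecker.

(** * An annihilating polynomial *)

Section Annihilator.
Variables (R : realType) (X : topologicalZmodType) (alpha : topAut X).
Variables (c s : X -> R) (I : (X -> R) -> R).
Hypotheses (hausX : hausdorff_space X) (compX : compact [set: X]).
Hypotheses (connX : connected [set: X]) (irr : irreducible_aut alpha).
Hypotheses (mI : invariant_mean I).
Hypotheses (cs : character c s) (cn1 : exists a, c a != 1).
Local Notation act := (poly_act alpha).

(** Compactness turns approximation on finite time windows into an exact solution for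
    all times; shifting time makes the windows symmetric. *)
Lemma constant_orbit x0 :
  (forall f : {poly int}, f != 0 -> exists a, act f a <> 0) ->
  exists x, forall n : int, c (aut_iter alpha n x - x0) = 1.
Proof.
move=> indep.
pose C (N : nat) := [set x | forall n : int, (`|n| <= N)%N ->
  1 - N.+1%:R^-1 <= c (aut_iter alpha n x - x0)].
have C0 N : C N !=set0.
  have N0 : 0 < N.+1%:R^-1 :> R by rewrite invr_gt0.
  have [x xP] := kronecker_orbit hausX compX connX irr mI cs cn1 indep x0 (2 * N).+1 N0.
  have [y yx] := aut_iter_surj alpha (- N%:Z) x.
  exists y => n nN; have -> : n = - N%:Z + `|(n + N%:Z)%R|%N%:Z by lia.
  by rewrite aut_iterD yx; apply/ltW/xP; lia.
have Ccl N : closed (C N).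
  rewrite (_ : C N = \bigcap_(n in [set n : int | (`|n| <= N)%N])
      [set x | 1 - N.+1%:R^-1 <= c (aut_iter alpha n x - x0)]); last first.
    by apply/seteqP; split.
  apply: closed_bigI => n _.
  apply: (@preimage_closed _ _ (fun x => c (aut_iter alpha n x - x0))
    [set r | 1 - N.+1%:R^-1 <= r]); last exact: closed_ge.
  move=> x _; apply: (@cont_comp _ _ _ (aut_iter alpha n) (fun z => c (z - x0))).
    exact: aut_iter_cont.
  by apply: cont_shiftr; exact: char_cos_cont cs.
have CS (i j : nat) : (i <= j)%N -> C j `<=` C i.
  move=> ij x Cx n ni; apply: le_trans (Cx n (leq_trans ni ij)).
  by rewrite lerD2l lerN2 lef_pV2 ?posrE // ler_nat.
pose F : set_system X := filter_from [set: nat] C.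
have FF : ProperFilter F.
  apply: filter_from_proper => //; apply: filter_from_filter; first by exists 0%N.
  move=> i j _ _; exists (maxn i j) => // x Cx; split.
    by apply: CS Cx; exact: leq_maxl.
  by apply: CS Cx; exact: leq_maxr.
have [|x [_ xcl]] := @compX F FF; first by exists 0%N.
have xC N : C N x.
  apply: Ccl => U xU; have [|y [Cy Uy]] := xcl (C N) U _ xU; first by exists N.
  by exists y.
exists x => n; apply/eqP; rewrite eq_le; apply/andP; split.
  by apply: le_trans (ler_norm _) _; exact: char_norm_le cs _.
apply/ler_addgt0Pr => e e0.
have [N _ NP] := near_infty_natSinv_lt (PosNum e0).
have := xC (maxn N `|n|) n (leq_maxr _ _).
have := NP (maxn N `|n|) (leq_maxl _ _).
by rewrite /=; move: (_^-1) => z; lra.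
Qed.

(** The subgroup [H] of the points along whose orbit the character is constant is
    proper, hence finite, if no polynomial annihilates, while [constant_orbit] makes [c] take on [H] all its values on the connected
    group [X]. *)
Lemma annihilator : exists2 f : {poly int}, f != 0 & forall x, act f x = 0.
Proof.
apply: contrapT => none.
have indep (f : {poly int}) : f != 0 -> exists a, act f a <> 0.
  by move=> f0; apply: contrapT => na; apply: none; exists f => // x;
     apply: contrapT => fx; apply: na; exists x.
pose H := [set x | orbit_kernel alpha c (alpha x - x)].
have [b cb] := cn1.
have [w] : exists w, act ('X - 1) w = b.
  have [|a fa] := indep ('X - 1); first by rewrite -polyC1 polyXsubC_eq0.
  exact: (poly_act_surj hausX compX connX irr fa).
have -> : act ('X - 1) w = alpha w - w.
  by rewrite -[X in X - 1]mul1r -polyC1 -polyCN poly_actD poly_actMX !poly_actC mulr1z mulrN1z.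
move=> wb.
have fH : finite_set H.
  apply: (@proper_invariant_finite _ _ irr _ w).
  - apply: (@orbit_kernel_closed _ alpha _ _ _ cs (fun x => alpha x - x)) => x.
    by apply: cvg_add_group; [exact: aut_fun_continuous|exact: opp_continuous].
  - split=> [|x y Hx Hy].
      by rewrite /H /= raddf0 subr0; exact: orbit_kernel0 cs.
    rewrite /H /= (_ : alpha (x - y) - (x - y) = alpha x - x - (alpha y - y)).
      exact: (orbit_kernelB cs).
    by rewrite raddfB !opprB addrACA [RHS]addrACA [- x + _]addrC.
  - by move=> x; rewrite /H /= -raddfB; exact: orbit_kernel_aut.
  - by move=> /(_ 0) /=; rewrite wb; apply/eqP.
have cH : c @` [set: X] = c @` H.
  apply/seteqP; split=> [_ [x0 _ <-]|_ [x Hx <-]]; last by exists x.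
  have [x xP] := constant_orbit x0 indep.
  exists x; last by rewrite (char_ker_eq cs (xP 0)).
  move=> n; rewrite aut_iterB aut_iter_aut.
  have -> : aut_iter alpha (n + 1) x - aut_iter alpha n x =
    (aut_iter alpha (n + 1) x - x0) - (aut_iter alpha n x - x0).
    by rewrite opprB addrA subrK.
  exact: (char_kerB cs).
have c1 : c @` [set: X] = [set 1].
  apply: connected_finite.
  - exact: Rhausdorff.
  - apply: connected_continuous_connected => //; apply: continuous_subspaceT.
    exact: char_cos_cont cs.
  - by rewrite cH; exact: finite_image.
  - by exists 0 => //; exact: char_cos0 cs.
have : (c @` [set: X]) (c b) by exists b.
by rewrite c1 /=; apply/eqP.
Qed.

End Annihilator.

(** * Linear recurrences with complex coefficients *)

Section Recurrence.
Variable R : realType.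
Local Notation C := R[i].
Implicit Types (f g : {poly C}) (b v : int -> C).

(** The modulus as an element of [R], where the ordering is total. *)
Definition cnorm (x : C) : R := complex.Re `|x|.

Lemma cnormE x : (cnorm x)%:C = `|x|.
Proof. by rewrite /cnorm RRe_real ?normr_real. Qed.

Lemma cnorm_ge0 x : 0 <= cnorm x.
Proof. by rewrite -lecR cnormE normr_ge0. Qed.

Lemma cnormM x y : cnorm (x * y) = cnorm x * cnorm y.
Proof. by apply: (@complexI R); rewrite rmorphM /= !cnormE normrM. Qed.

Lemma cnormD x y : cnorm (x + y) <= cnorm x + cnorm y.
Proof. by rewrite -lecR rmorphD /= !cnormE ler_normD. Qed.

Lemma cnormN x : cnorm (- x) = cnorm x.
Proof. by rewrite /cnorm normrN. Qed.

Lemma cnorm_eq0 x : cnorm x = 0 -> x = 0.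
Proof. by move=> x0; apply/normr0_eq0; rewrite -cnormE x0. Qed.

Lemma cnormX x k : cnorm (x ^+ k) = cnorm x ^+ k.
Proof. by apply: (@complexI R); rewrite rmorphXn /= !cnormE normrX. Qed.

Lemma cnorm_real (a : R) : cnorm a%:C = `|a|.
Proof. by rewrite /cnorm normc_def /= expr0n addr0 sqrtr_sqr. Qed.

Definition seq_act f b (n : int) : C := \sum_(i < size f) f`_i * b (n + i%:Z).

Lemma seq_actE N f b n : (size f <= N)%N ->
  seq_act f b n = \sum_(i < N) f`_i * b (n + i%:Z).
Proof.
move=> fN; rewrite /seq_act (big_ord_widen N (fun i => f`_i * b (n + i%:Z))) //.
rewrite big_mkcond; apply: eq_bigr => i _.
by case: ltnP => // fi; rewrite nth_default // mul0r.
Qed.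

(** Multiplying by a linear factor applies the first order operator before [f]; by
    commutativity it may be applied after [f], as in [seq_act_step]. *)
Lemma seq_act_factor f rho b n :
  seq_act (f * ('X - rho%:P)) b n = seq_act f (fun m => b (m + 1) - rho * b m) n.
Proof.
have sz : (size (f * ('X - rho%:P))%R <= (size f).+1)%N.
  by apply: leq_trans (size_polyMleq _ _) _; rewrite size_XsubC addn2.
rewrite (seq_actE b n sz) /seq_act mulrBr.
under eq_bigr do rewrite coefB coefMX coefMC mulrBl.
rewrite sumrB big_ord_recl eqxx mul0r add0r [X in _ - X]big_ord_recr /=.
rewrite nth_default // mul0r mul0r addr0 -sumrB; apply: eq_bigr => i _.
rewrite mulrBr; congr (f`_i * b _ - _); first by rewrite /bump /=; lia.
by rewrite mulrA.
Qed.

Lemma seq_act_step f rho b n :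
  seq_act (f * ('X - rho%:P)) b n = seq_act f b (n + 1) - rho * seq_act f b n.
Proof.
rewrite seq_act_factor /seq_act mulr_sumr -sumrB; apply: eq_bigr => i _.
rewrite mulrBr addrAC; congr (_ - _); by rewrite mulrCA.
Qed.

(** Split off one root at a time: it suffices that no nonzero geometric progression
    with a ratio among the roots of [f] has property [Q]. *)
Lemma recurrence_eq0 (Q : (int -> C) -> Prop) f b :
  (forall v rho, Q v -> Q (fun n => v (n + 1) - rho * v n)) ->
  (forall v rho, root f rho -> Q v -> (forall n, v (n + 1) = rho * v n) ->
     forall n, v n = 0) ->
  f != 0 -> Q b -> (forall n, seq_act f b n = 0) -> forall n, b n = 0.
Proof.
move=> Qd; move: {2}(size f) (leqnn (size f)) => k.
elim: k f b => [|k IH] f b sf Qr f0 Qb fb.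
  by rewrite leqn0 size_poly_eq0 (negbTE f0) in sf.
have [sf1|sf1] := leqP (size f) 1.
  move=> n; have := fb n; rewrite (seq_actE _ _ sf1) big_ord1 addr0 => /eqP.
  rewrite mulf_eq0 => /orP[|/eqP//].
  by rewrite (size1_polyC sf1) coefC eqxx -polyC_eq0 -(size1_polyC sf1) (negbTE f0).
have [rho rf] : exists rho, root f rho by apply/closed_rootP; rewrite gtn_eqF.
have /factor_theorem[g fE] := rf.
have g0 : g != 0 by apply: contraNneq f0 => g0; rewrite fE g0 mul0r.
apply: (Qr _ rho) => // n; apply/eqP; rewrite -subr_eq0; apply/eqP.
apply: (IH g (fun m => b (m + 1) - rho * b m)) => //.
- by move: sf; rewrite fE size_Mmonic ?monicXsubC // size_XsubC addn2.
- by move=> v r rg; apply: Qr; rewrite fE rootM rg.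
- exact: Qd.
- by move=> m; rewrite -seq_act_factor -fE.
Qed.

Definition bounded_seq b := exists M, forall n, cnorm (b n) <= M.
Definition vanishing_seq b := forall e, 0 < e ->
  exists N : nat, forall n : int, (N <= `|n|)%N -> cnorm (b n) < e.

Lemma bounded_seq_diff b rho : bounded_seq b ->
  bounded_seq (fun n => b (n + 1) - rho * b n).
Proof.
move=> [M bM]; exists (M + cnorm rho * M) => n.
apply: le_trans (cnormD _ _) _; rewrite cnormN cnormM.
by apply: lerD => //; rewrite ler_wpM2l ?cnorm_ge0.
Qed.

Lemma vanishing_seqD b v : vanishing_seq b -> vanishing_seq v ->
  vanishing_seq (fun n => b n + v n).
Proof.
move=> vb vv e e0; have e2 : 0 < e / 2 by rewrite divr_gt0.
have [N1 h1] := vb _ e2; have [N2 h2] := vv _ e2.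
exists (maxn N1 N2) => n; rewrite geq_max => /andP[n1 n2].
by apply: le_lt_trans (cnormD _ _) _; have := h1 n n1; have := h2 n n2; lra.
Qed.

Lemma vanishing_seqZ a b : vanishing_seq b -> vanishing_seq (fun n => a * b n).
Proof.
move=> vb e e0; have a1 : 0 < cnorm a + 1 by rewrite ltr_wpDl ?cnorm_ge0.
have [N h] := vb _ (divr_gt0 e0 a1); exists N => n /h.
rewrite ltr_pdivlMr // cnormM => hn; apply: le_lt_trans hn.
by rewrite mulrC ler_wpM2l ?cnorm_ge0 // lerDl.
Qed.

Lemma vanishing_seq_shift b m : vanishing_seq b -> vanishing_seq (fun n => b (n + m)).
Proof. by move=> vb e /vb[N h]; exists (N + `|m|)%N => n nN; apply: h; lia. Qed.

Lemma vanishing_seq_diff b rho : vanishing_seq b ->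
  vanishing_seq (fun n => b (n + 1) - rho * b n).
Proof.
move=> vb; have h := vanishing_seqD (vanishing_seq_shift 1 vb) (vanishing_seqZ (- rho) vb).
by move=> e /h[N hN]; exists N => n /hN; rewrite mulNr.
Qed.

Lemma vanishing_seq_act f b : vanishing_seq b -> vanishing_seq (seq_act f b).
Proof.
move=> vb; rewrite /seq_act; elim: (size f) => [|k IH].
  by move=> e e0; exists 0%N => n _; rewrite big_ord0 /cnorm normr0.
have h := vanishing_seqD IH (vanishing_seqZ f`_k (vanishing_seq_shift k%:Z vb)).
by move=> e /h[N hN]; exists N => n /hN; rewrite big_ord_recr.
Qed.

Lemma geometric_iter v rho n (k : nat) :
  (forall m, n <= m -> v (m + 1) = rho * v m) -> v (n + k%:Z) = rho ^+ k * v n.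
Proof.
move=> h; elim: k => [|k IH]; first by rewrite addr0 mul1r.
have -> : n + k.+1%:Z = n + k%:Z + 1 by lia.
by rewrite h ?IH ?exprS ?mulrA //; lia.
Qed.

(** The modulus does not decrease along a progression of ratio at least 1. *)
Lemma vanish_forward v rho n : vanishing_seq v -> 1 <= cnorm rho ->
  (forall m, n <= m -> v (m + 1) = rho * v m) -> v n = 0.
Proof.
move=> vv r1 h; apply: cnorm_eq0; apply/eqP; rewrite eq_le cnorm_ge0 andbT.
apply/ler_addgt0Pr => e e0; rewrite add0r; have [N hN] := vv e e0.
have := hN (n + (N + `|n|)%N%:Z) ltac:(lia).
rewrite (geometric_iter _ h) cnormM cnormX => /ltW; apply: le_trans.
by rewrite ler_peMl ?cnorm_ge0 // exprn_ege1.
Qed.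

Lemma vanish_backward v rho n : vanishing_seq v -> cnorm rho <= 1 ->
  (forall m, m < n -> v (m + 1) = rho * v m) -> v n = 0.
Proof.
move=> vv r1 h; apply: cnorm_eq0; apply/eqP; rewrite eq_le cnorm_ge0 andbT.
apply/ler_addgt0Pr => e e0; rewrite add0r; have [N hN] := vv e e0.
pose k := (N + `|n|)%N.
have := hN (n - k%:Z) ltac:(lia).
have -> : v n = rho ^+ k * v (n - k%:Z).
  elim: k => [|k IH]; first by rewrite subr0 mul1r.
  rewrite IH exprSr -mulrA -h; last by lia.
  by congr (_ * v _); lia.
rewrite cnormM cnormX => /ltW; apply: le_trans.
by rewrite ler_piMl ?cnorm_ge0 // exprn_ile1 ?cnorm_ge0.
Qed.

(** A nonzero geometric progression cannot tend to 0 at both ends of time. *)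
Lemma vanishing_recurrence f b : f != 0 -> vanishing_seq b ->
  (forall n, seq_act f b n = 0) -> forall n, b n = 0.
Proof.
apply: recurrence_eq0; first by move=> v rho; exact: vanishing_seq_diff.
move=> v rho _ vv h n; have [r1|r1] := lerP 1 (cnorm rho).
  exact: (vanish_forward vv r1).
by apply: (vanish_backward vv (ltW r1)).
Qed.

Lemma geometric_small (q a M : R) : 0 <= q -> q < 1 -> (forall k : nat, a <= q ^+ k * M) ->
  a <= 0.
Proof.
move=> q0 q1 h; apply/ler_addgt0Pr => e e0; rewrite add0r.
have M1 : 0 < `|M| + 1 by rewrite ltr_wpDl.
have /cvgrPdist_lt/(_ _ (divr_gt0 e0 M1)) : (fun k => q ^+ k) @ \oo --> 0.
  by apply: cvg_expr; rewrite ger0_norm.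
move=> [N _ /(_ N (leqnn _))] /=; rewrite sub0r normrN ger0_norm ?exprn_ge0 //.
rewrite ltr_pdivlMr // => qN; apply: le_trans (h N) _; apply: le_trans (ltW qN).
rewrite ler_wpM2l ?exprn_ge0 //; apply: le_trans (ler_norm _) _; lra.
Qed.

(** A nonzero geometric progression of ratio off the unit circle is unbounded at one
    end of time. *)
Lemma bounded_recurrence f b : f != 0 -> (forall rho, root f rho -> cnorm rho != 1) ->
  bounded_seq b -> (forall n, seq_act f b n = 0) -> forall n, b n = 0.
Proof.
move=> f0 fr; apply: recurrence_eq0 => //; first by move=> v rho; exact: bounded_seq_diff.
move=> v rho /fr r1 [M vM] h n.
apply: cnorm_eq0; apply/eqP; rewrite eq_le cnorm_ge0 andbT.
move: r1; rewrite neq_lt => /orP[r1|r1].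
  apply: (geometric_small (cnorm_ge0 rho) r1 (M := M)) => k.
  have := @geometric_iter v rho (n - k%:Z) k (fun m _ => h m).
  rewrite subrK => ->; rewrite cnormM cnormX.
  by rewrite ler_wpM2l // exprn_ge0 // cnorm_ge0.
have r0 : 0 < cnorm rho by apply: lt_trans r1.
apply: (@geometric_small (cnorm rho)^-1 _ M); rewrite ?invr_ge0 ?cnorm_ge0 ?invf_lt1 //.
move=> k; rewrite exprVn mulrC ler_pdivlMr ?exprn_gt0 // mulrC -cnormX -cnormM.
by rewrite -(@geometric_iter v rho n k (fun m _ => h m)).
Qed.

End Recurrence.

(** * Real angles of a character *)

Lemma cosD2piz (R : realType) (k : int) (a : R) : cos (a + 2 * pi * k%:~R) = cos a.
Proof.
have nat_case (n : nat) (b : R) : cos (b + 2 * pi * n%:R) = cos b.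
  rewrite -[RHS](periodicn (@cosD2pi R) n); congr (cos (_ + _)).
  by rewrite mulr_natr mulr_natl.
case: k => n; first exact: nat_case.
rewrite NegzE mulrNz mulrN -[LHS](nat_case n.+1).
by rewrite subrK.
Qed.

(** Reduce to [0, 2 pi), where [cos] is injective on each half. *)
Lemma cos_eq1_2pi (R : realType) (b : R) : cos b = 1 ->
  exists k : int, b = 2 * pi * k%:~R.
Proof.
move=> cb; have pi0 := pi_gt0 R; pose k := Num.floor (b / (2 * pi)); exists k.
have p2 : 0 < 2 * pi :> R by rewrite mulr_gt0.
pose r := b - 2 * pi * k%:~R.
have cr : cos r = 1 by rewrite -(cosD2piz k) subrK.
have [k1 k2] : k%:~R <= b / (2 * pi) /\ b / (2 * pi) < k%:~R + 1.
  have /andP[] := real_floor_itv (num_real (b / (2 * pi))); rewrite -/k => k1.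
  by rewrite intrD.
have r0 : 0 <= r.
  by rewrite subr_ge0 mulrC -ler_pdivlMr.
have r2 : r < 2 * pi.
  by rewrite ltrBlDl -[X in _ + X]mulr1 -mulrDr mulrC -ltr_pdivrMr.
suff r00 : r = 0 by apply/eqP; rewrite -subr_eq0 -/r r00.
have cosI (u : R) : 0 <= u -> u <= pi -> cos u = 1 -> u = 0.
  move=> u0 up cu; apply: (@cos_inj R); rewrite ?in_itv /= ?u0 ?up ?lexx ?(ltW pi0) //.
  by rewrite cu cos0.
have [rp|rp] := leP r pi; first exact: cosI.
have : 2 * pi - r = 0.
  apply: cosI; [lra|lra|].
  by rewrite -cosN opprB -(cosD2piz 1) mulr1 subrK.
lra.
Qed.

Section Angles.
Variables (R : realType) (X : topologicalZmodType) (c s : X -> R).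
Hypothesis cs : character c s.

Definition is_angle x a := c x = cos a /\ s x = sin a.

Lemma is_angleD x y a b : is_angle x a -> is_angle y b -> is_angle (x + y) (a + b).
Proof.
move=> [ca sa] [cb sb]; split.
  by rewrite (char_cosD cs) ca sa cb sb cosD.
by rewrite (char_sinD cs) ca sa cb sb sinD.
Qed.

Lemma is_angleN x a : is_angle x a -> is_angle (- x) (- a).
Proof. by move=> [ca sa]; split; rewrite ?(char_cosN cs) ?(char_sinN cs) ?cosN ?sinN ?ca ?sa. Qed.

Lemma is_angle0 : is_angle 0 0.
Proof. by split; rewrite ?(char_cos0 cs) ?(char_sin0 cs) ?cos0 ?sin0. Qed.

Lemma is_angleMz x a (k : int) : is_angle x a -> is_angle (x *~ k) (a * k%:~R).
Proof.
move=> xa; have nat_case (n : nat) : is_angle (x *+ n) (a * n%:R).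
  elim: n => [|n IH]; first by rewrite mulr0n mulr0; exact: is_angle0.
  by rewrite mulrS -natr1 mulrDr mulr1 addrC; exact: is_angleD.
case: k => n; first exact: nat_case.
by rewrite NegzE !mulrNz mulrN; apply: is_angleN; exact: nat_case.
Qed.

Lemma is_angle_sum (n : nat) (x : 'I_n -> X) (a : 'I_n -> R) :
  (forall i, is_angle (x i) (a i)) -> is_angle (\sum_i x i) (\sum_i a i).
Proof.
move=> xa; elim/big_rec2: _ => [|i y b _ yb]; first exact: is_angle0.
exact: is_angleD.
Qed.

(** A lift of the character to the interval from [- pi] to [pi]; it is small when the
    character is close to 1. *)
Definition angle x := if 0 <= s x then acos (c x) else - acos (c x).

Lemma acos_char x : 0 <= acos (c x) <= pi /\ cos (acos (c x)) = c x.
Proof. by apply: acos_def; rewrite -ler_norml; exact: char_norm_le cs x. Qed.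

Lemma angleP x : is_angle x (angle x).
Proof.
have [/andP[a0 ap] ca] := acos_char x.
have sa : 0 <= sin (acos (c x)) by apply: sin_ge0_pi; rewrite a0.
have s2 : s x ^+ 2 = sin (acos (c x)) ^+ 2.
  have := cos2Dsin2 (acos (c x)); rewrite ca; have := char_norm cs x; lra.
rewrite /is_angle /angle; case: leP => sx; split; rewrite ?cosN ?sinN ?ca //.
  by apply/eqP; rewrite -(@eqrXn2 _ 2) ?s2.
apply/eqP; rewrite -eqr_opp opprK -(@eqrXn2 _ 2) ?sqrrN ?s2 //.
by rewrite oppr_ge0 ltW.
Qed.

Lemma angle_lt x d : 0 < d -> d <= pi -> cos d < c x -> `|angle x| < d.
Proof.
move=> d0 dp cd; have [/andP[a0 ap] ca] := acos_char x.
have -> : `|angle x| = acos (c x).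
  by rewrite /angle; case: ifP; rewrite ?normrN ger0_norm.
by rewrite -(@ltr_cos R) ?in_itv /= ?a0 ?ap ?(ltW d0) ?dp // ca.
Qed.

Lemma angle_eq0 x : angle x = 0 -> c x = 1.
Proof. by move=> a0; have [-> _] := angleP x; rewrite a0 cos0. Qed.

End Angles.

(** * Annihilators without roots on the unit circle *)

Section AngleSums.
Variables (R : realType) (X : topologicalZmodType) (alpha : topAut X).
Variables (c s : X -> R).
Hypotheses (hausX : hausdorff_space X).
Hypotheses (connX : connected [set: X]) (irr : irreducible_aut alpha).
Hypotheses (cs : character c s) (cn1 : exists a, c a != 1).
Local Notation act := (poly_act alpha).
Local Notation ang := (angle c s).
Local Notation toC := (map_poly (intmul (1 : R[i]))).

(** The character takes values of arbitrarily small positive angle because [X] is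
    connected; an angle [th] with [th * |k|] at most [pi] is not killed by [k]. *)
Lemma mulrz_nontrivial (k : int) : k != 0 -> exists a, a *~ k <> 0 :> X.
Proof.
move=> k0; apply: contrapT => none.
have kx (x : X) : x *~ k = 0 by apply: contrapT => xk; apply: none; exists x.
have [a ca] := cn1.
have itv : is_interval (c @` [set: X]).
  apply/connected_intervalP; apply: connected_continuous_connected => //.
  by apply: continuous_subspaceT; exact: char_cos_cont cs.
have ca1 : c a < 1.
  by rewrite lt_neqAle ca (le_trans (ler_norm _)) // (char_norm_le cs).
have [/andP[ac0 acp] cac] := acos_char cs a.
have ac_gt0 : 0 < acos (c a).
  by rewrite lt_neqAle ac0 andbT; apply: contra ca => /eqP e; rewrite -cac -e cos0.
have pi0 := pi_gt0 R.
have kn0 : 0 < `|k%:~R| :> R by rewrite normr_gt0 intr_eq0.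
have k1 : 1 <= `|k%:~R| :> R.
  by rewrite -intr_norm -[1]/(1%:~R) ler_int -gtz0_ge1 normr_gt0.
pose th := Num.min (acos (c a)) pi / `|k%:~R|.
have min0 : 0 < Num.min (acos (c a)) pi by rewrite lt_min ac_gt0 pi0.
have th0 : 0 < th by rewrite divr_gt0.
have thk : th * `|k%:~R| <= pi by rewrite divfK ?lt0r_neq0 // ge_min lexx orbT.
have tha : th <= acos (c a).
  by rewrite ler_pdivrMr // (le_trans (_ : _ <= acos (c a))) ?ge_min ?lexx // ler_peMr.
have thp : th <= pi by apply: le_trans acp.
have [x _ cx] : (c @` [set: X]) (cos th).
  apply: (itv (c a) 1); first by exists a.
    by exists 0 => //; exact: char_cos0 cs.
  apply/andP; split; last exact: cos_le1.
  rewrite -cac leNgt (@ltr_cos R) ?in_itv /= ?ac0 ?acp ?(ltW th0) ?thp //.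
  by rewrite -leNgt.
have ath : `|ang x| = th.
  have -> : `|ang x| = acos (c x).
    have [/andP[a0 _] _] := acos_char cs x.
    by rewrite /angle; case: ifP; rewrite ?normrN ger0_norm.
  by rewrite cx cosK // in_itv /= (ltW th0) thp.
have [ck _] := is_angleMz cs k (angleP cs x).
have : cos (th * `|k%:~R|) = 1.
  rewrite -ath -normrM; have -> : cos `|ang x * k%:~R| = cos (ang x * k%:~R).
    by case: (ger0P (ang x * k%:~R)) => _ //; rewrite cosN.
  by rewrite -ck kx (char_cos0 cs).
have tk0 : 0 < th * `|k%:~R| by rewrite mulr_gt0.
move=> e; have : th * `|k%:~R| = 0.
  by apply: (@cos_inj R); rewrite ?in_itv /= ?(ltW tk0) ?thk ?lexx ?(ltW pi0) // e cos0.
by move=> z; rewrite z ltxx in tk0.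
Qed.

Definition angle_sum (f : {poly int}) x (n : int) : R :=
  \sum_(i < size f) ang (aut_iter alpha (n + i%:Z) x) * (f`_i)%:~R.

Lemma angle_sum_int f x n : (forall y, act f y = 0) ->
  exists k : int, angle_sum f x n = 2 * pi * k%:~R.
Proof.
move=> f0; apply: cos_eq1_2pi.
have [<- _] : is_angle c s (act f (aut_iter alpha n x)) (angle_sum f x n).
  rewrite /poly_act /angle_sum; apply: (is_angle_sum cs) => i.
  by rewrite -aut_iterD; apply: (is_angleMz cs); exact: angleP cs _.
by rewrite f0 (char_cos0 cs).
Qed.

Lemma angle_sumE f x n :
  seq_act (toC f) (fun m => (ang (aut_iter alpha m x))%:C) n = (angle_sum f x n)%:C.
Proof.
rewrite (seq_actE _ _ (size_poly _ _)) rmorph_sum /=; apply: eq_bigr => i _.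
by rewrite coef_map rmorphM /= mulrC rmorph_int.
Qed.

Lemma toC_neq0 f : f != 0 -> toC f != 0.
Proof. by move=> f0; rewrite map_poly_eq0_id0 // intr_eq0 lead_coef_eq0. Qed.

(** Along an orbit that stays where the angles are below [d], the sums [angle_sum f]
    are multiples of [2 pi] of absolute value below [pi], hence 0, and the bounded
    sequence of angles solves the recurrence.  So the orbit is killed by the
    character, and a neighbourhood isolating 0 in [orbit_kernel] finishes. *)
Lemma expansive_of_no_unit_root (f : {poly int}) : f != 0 -> (forall y, act f y = 0) ->
  (forall w, root (toC f) w -> cnorm w != 1) -> expansive alpha.
Proof.
move=> f0 fz fr; have pi0 := pi_gt0 R.
pose M : R := \sum_(i < size f) `|(f`_i)%:~R|.
have M0 : 0 <= M by apply: sumr_ge0.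
(* The weights of the recurrence add up to [M], so angles below [d] give sums
   below [pi]. *)
pose d := pi / (M + 1).
have M1 : 0 < M + 1 by rewrite ltr_wpDl.
have d0 : 0 < d by rewrite divr_gt0.
have dp : d <= pi by rewrite ler_pdivrMr // ler_peMr ?(ltW pi0) // lerDr.
have dM : d * M < pi.
  by rewrite mulrAC ltr_pdivrMr // ltr_pM2l // ltrDl.
have cd1 : cos d < 1.
  by rewrite -(@cos0 R) (@ltr_cos R) ?in_itv /= ?lexx ?(ltW pi0) ?(ltW d0) ?dp.
have fK := orbit_kernel_finite irr cs cn1.
pose K := orbit_kernel alpha c.
exists ([set x | cos d < c x] `&` ~` (K `\ 0)).
  apply: open_nbhs_nbhs; split; last first.
    by split; [rewrite /= (char_cos0 cs)|move=> [_]; apply].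
  apply: openI.
    apply: (@open_comp _ _ c [set r | cos d < r]); last exact: open_gt.
    by move=> x _; exact: char_cos_cont cs x.
  apply: closed_openC; apply: (accessible_finite_set_closed.1 _ _ (finite_setD _ fK)).
  exact: hausdorff_accessible.
apply/seteqP; split=> [x Ux|_ ->] /=; last first.
  move=> n; rewrite aut_iter0; split; first by rewrite /= (char_cos0 cs).
  by move=> [_]; apply.
apply: contrapT => x0; have [_ /=] := Ux 0; apply; split=> //.
pose a m := ang (aut_iter alpha m x).
have ad m : `|a m| < d by apply: (angle_lt cs) => //; have [] := Ux m.
have t0 n : angle_sum f x n = 0.
  have [k tk] := angle_sum_int x n fz.
  have : `|angle_sum f x n| < pi.
    apply: le_lt_trans dM; rewrite mulr_sumr; apply: le_trans (ler_norm_sum _ _ _) _.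
    by apply: ler_sum => i _; rewrite normrM; apply: ler_wpM2r => //; exact/ltW/ad.
  rewrite tk !normrM gtr0_norm // gtr0_norm // => h.
  have [->|k0] := eqVneq k 0; first by rewrite mulr0.
  have k1 : 1 <= `|k%:~R| :> R.
    by rewrite -intr_norm -[1]/(1%:~R) ler_int -gtz0_ge1 normr_gt0.
  by move: h; nra.
have a0 : forall n, (a n)%:C = 0.
  apply: (bounded_recurrence (toC_neq0 f0) fr).
    by exists d => n; rewrite cnorm_real ltW.
  by move=> n; rewrite angle_sumE t0.
move=> n; apply: (angle_eq0 cs); apply: (@complexI R); exact: a0.
Qed.
End AngleSums.

(** * Homoclinic points and roots on the unit circle *)

Section MinimalPolynomial.
Variables (R : realType) (w : R[i]).
Local Notation toC := (map_poly (intmul (1 : R[i]))).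

(** Pseudo-division by an integer polynomial of least degree vanishing at [w]; the
    factor [k] is a power of its leading coefficient. *)
Lemma minimal_integer_poly (f : {poly int}) : f != 0 -> root (toC f) w ->
  exists g : {poly int}, [/\ g != 0, root (toC g) w &
    forall p : {poly int}, root (toC p) w ->
      exists2 k : int, k != 0 & exists G : {poly int}, k *: p = G * g].
Proof.
move=> f0 fw.
pose S n := `[< exists g : {poly int}, [/\ g != 0, root (toC g) w & size g = n] >].
have exS : exists n, S n by exists (size f); apply/asboolP; exists f.
case: (ex_minnP exS) => n /asboolP[g [g0 gw gn]] nmin.
exists g; split=> // p pw; exists (lead_coef g ^+ scalp p g).
  by rewrite expf_neq0 // lead_coef_eq0.
exists (p %/ g); have divE := Pdiv.Idomain.divp_eq p g.
suff r0 : p %% g = 0 by rewrite divE r0 addr0.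
apply/eqP; apply: contraT => r0.
have : (n <= size (p %% g)%R)%N.
  apply: nmin; apply/asboolP; exists (p %% g); split=> //.
  have -> : p %% g = lead_coef g ^+ scalp p g *: p - p %/ g * g.
    by rewrite divE addrAC subrr add0r.
  rewrite rootE rmorphB rmorphM /= -mul_polyC rmorphM /= hornerD hornerN !hornerM.
  by rewrite (eqP pw) (eqP gw) !mulr0 subr0.
by rewrite -gn leqNgt ltn_modp g0.
Qed.
End MinimalPolynomial.

Section Homoclinic.
Variables (R : realType) (X : topologicalZmodType) (alpha : topAut X).
Variables (c s : X -> R).
Hypotheses (hausX : hausdorff_space X) (compX : compact [set: X]).
Hypotheses (connX : connected [set: X]) (irr : irreducible_aut alpha).
Hypotheses (cs : character c s) (cn1 : exists a, c a != 1).
Local Notation act := (poly_act alpha).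
Local Notation ang := (angle c s).
Local Notation toC := (map_poly (intmul (1 : R[i]))).

Lemma homoclinic_Mz z k : homoclinic alpha z -> homoclinic alpha (z *~ k).
Proof.
move=> hz U U0; have [|N NP] := hz [set x | U (x *~ k)].
  have := @cont_mulrz X X id k (fun=> cvg_id) 0; rewrite /continuous_at mul0rz.
  by move/(_ U U0).
by exists N => n /NP; rewrite aut_iterMz.
Qed.

(** The [k]-torsion of [X] is finite and invariant. *)
Lemma homoclinic_torsion_eq0 z k : homoclinic alpha z -> k != 0 -> z *~ k = 0 -> z = 0.
Proof.
move=> hz k0 zk; have [a ak] := mulrz_nontrivial connX cs cn1 k0.
have fk : finite_set [set x | act k%:P x = 0].
  by apply: (@poly_act_ker_finite _ _ hausX irr _ a); rewrite poly_actC.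
apply: (@homoclinic_in_finite_eq0 _ alpha hausX _ z fk) => // n; rewrite /= poly_actC.
by rewrite -aut_iterMz zk aut_iter0.
Qed.

Lemma homoclinic_angle z : homoclinic alpha z ->
  vanishing_seq (fun n => (ang (aut_iter alpha n z))%:C).
Proof.
move=> hz e e0; have pi0 := pi_gt0 R.
pose d := Num.min e pi.
have d0 : 0 < d by rewrite lt_min e0.
have dp : d <= pi by rewrite ge_min lexx orbT.
have cd1 : cos d < 1.
  by rewrite -(@cos0 R) (@ltr_cos R) ?in_itv /= ?lexx ?(ltW pi0) ?(ltW d0) ?dp.
have [|N NP] := hz [set x | cos d < c x].
  apply: open_nbhs_nbhs; split; last by rewrite /= (char_cos0 cs).
  apply: (@open_comp _ _ c [set r | cos d < r]); last exact: open_gt.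
  by move=> x _; exact: char_cos_cont cs x.
exists N => n /NP cn; rewrite cnorm_real.
by apply: lt_le_trans (angle_lt cs d0 dp cn) _; rewrite ge_min lexx.
Qed.

(** With [g] the minimal polynomial of [w], which also annihilates [X], and [q] the
    integral, finitely supported sequence [g a / 2 pi]: factor [g = g1 (t - w)] and
    set [v = g1 a].  Outside the support of [q] the sequence [v] is geometric of
    ratio [w] and tends to 0, so it vanishes there; summing the recurrence across
    the support gives the value 0 at [w] to the polynomial [P] with the entries of [q]
    as coefficients.  Then [k P = G g], so [k a] and [2 pi G], reindexed as [b],
    solve the same recurrence; their difference tends to 0 and is 0. *)
Lemma homoclinic_eq0_of_unit_root (f : {poly int}) (w : R[i]) z :
  f != 0 -> (forall y, act f y = 0) ->
  (forall g : {poly int}, g != 0 -> (forall y, act g y = 0) -> (size f <= size g)%N) ->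
  root (toC f) w -> cnorm w = 1 -> homoclinic alpha z -> z = 0.
Proof.
move=> f0 fz fmin fw w1 hz.
have [g [g0 gw gdiv]] := minimal_integer_poly f0 fw.
have szg : (1 < size g)%N.
  rewrite ltnNge; apply/negP => g1; move: gw.
  rewrite (size1_polyC g1) map_polyC rootC /= intr_eq0.
  by rewrite -polyC_eq0 -(size1_polyC g1) (negbTE g0).
(* Otherwise the cofactor [G] would annihilate [X], against the minimality of
   [f]. *)
have gz y : act g y = 0.
  apply: contrapT => gy; have [k k0 [G kf]] := gdiv f fw.
  have G0 : G != 0.
    apply: contraNneq f0 => G0; move: kf; rewrite G0 mul0r => /eqP.
    by rewrite scale_poly_eq0 (negbTE k0).
  have Gz : act G =1 (fun=> 0).
    apply: (poly_act_prime hausX compX connX irr _ gy) => x.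
    by rewrite -kf poly_actZ fz mul0rz.
  have := fmin G G0 Gz; rewrite -(size_scale f k0) kf size_mul //.
  have : (0 < size G)%N by rewrite size_poly_gt0.
  move: szg; move: (size g) (size G) => m n. lia.
pose a n : R[i] := (ang (aut_iter alpha n z))%:C.
have av : vanishing_seq a := homoclinic_angle hz.
have [q qP] := choice (fun n => angle_sum_int cs z n gz).
have pi0 := pi_gt0 R.
have p2 : 0 < 2 * pi :> R by rewrite mulr_gt0.
have aq n : seq_act (toC g) a n = (2 * pi * (q n)%:~R)%:C by rewrite angle_sumE qP.
have [N qN] : exists N : nat, forall n : int, (N <= `|n|)%N -> q n = 0.
  have [N NP] := vanishing_seq_act (toC g) av p2; exists N => n /NP.
  rewrite aq cnorm_real normrM gtr0_norm // gtr_pMr // => q1.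
  apply/eqP; apply: contraTT q1 => qn0; rewrite -leNgt.
  by rewrite -intr_norm -[1]/(1%:~R) ler_int -gtz0_ge1 normr_gt0.
have /factor_theorem[g1 gE] := gw.
pose v := seq_act g1 a; have vv : vanishing_seq v by exact: vanishing_seq_act.
have vS n : v (n + 1) = w * v n + (2 * pi)%:C * (q n)%:~R.
  have := seq_act_step g1 w a n; rewrite -gE aq rmorphM /= rmorph_int => ->.
  by rewrite [RHS]addrC /v subrK.
have v0 n : (N%:Z <= n) || (n <= - N%:Z) -> v n = 0.
  move=> /orP[Nn|nN].
    apply: (@vanish_forward _ v w) => //; first by rewrite w1.
    by move=> m nm; rewrite vS qN ?mulr0 ?addr0 //; lia.
  apply: (@vanish_backward _ v w) => //; first by rewrite w1.
  by move=> m nm; rewrite vS qN ?mulr0 ?addr0 //; lia.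
(* Time is reversed and shifted: the coefficient of degree [j] is the entry of
   [q] at time [N - 1 - j]. *)
pose P : {poly int} := \poly_(j < 2 * N) q (N%:Z - 1 - j%:Z).
have Pw : root (toC P) w.
  have vk (k : nat) : v (- N%:Z + k%:Z) =
      (2 * pi)%:C * \sum_(j < k) (q (- N%:Z + k%:Z - 1 - j%:Z))%:~R * w ^+ j.
    elim: k => [|k IH]; first by rewrite big_ord0 mulr0 addr0 v0 // lexx orbT.
    have e : - N%:Z + k.+1%:Z = - N%:Z + k%:Z + 1 by lia.
    rewrite e vS IH big_ord_recl [RHS]mulrDr expr0 mulr1 subr0 addrK [RHS]addrC.
    congr (_ + _); rewrite mulrCA; congr (_ * _); rewrite mulr_sumr.
    apply: eq_bigr => j _; rewrite lift0 exprS mulrCA; congr (_ * _).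
    by congr ((q _)%:~R); lia.
  have := vk (2 * N)%N; have e : - N%:Z + (2 * N)%N%:Z = N%:Z by lia.
  rewrite e v0 ?lexx // => /esym/eqP; rewrite mulf_eq0 => /orP[|/eqP sum0].
    by rewrite -[0]/(0%:C) (inj_eq (@complexI R)) gt_eqF.
  rewrite rootE (@horner_coef_wide _ (2 * N)); last first.
    by apply: leq_trans (size_poly _ _) _; exact: size_poly.
  apply/eqP; rewrite -[RHS]sum0; apply: eq_bigr => j _.
  by rewrite coef_map coef_poly ltn_ord.
have [k k0 [G kP]] := gdiv P Pw.
pose b (n : int) : int := if N%:Z - 1 - n is Posz j then G`_j else 0.
have bact n : \sum_(i < size g) g`_i * b (n + i%:Z) = k * q n.
  have [[j jE]|nj] : (exists j : nat, N%:Z - 1 - n = j%:Z) \/ N%:Z <= n.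
    have [h|h] := leP N%:Z n; [by right|left; exists `|(N%:Z - 1 - n)%R|%N; lia].
    have -> : q n = P`_j.
      rewrite coef_poly; case: ltnP => [jN|jN]; first by congr q; lia.
      by apply: qN; lia.
    rewrite -coefZ kP coefMr.
    pose h (i : nat) := g`_i * b (n + i%:Z).
    have bE i : b (n + i%:Z) = if (i <= j)%N then G`_(j - i) else 0.
      rewrite /b; case: leqP => ij.
        by have -> : N%:Z - 1 - (n + i%:Z) = Posz (j - i)%N by lia.
      by have -> : N%:Z - 1 - (n + i%:Z) = Negz (i - j).-1 by lia.
    transitivity (\sum_(i < maxn (size g) j.+1) h i).
      rewrite [LHS](big_ord_widen (maxn (size g) j.+1) h) ?leq_maxl //.
      rewrite big_mkcond; apply: eq_bigr => i _.
      by case: ltnP => // gi; rewrite /h nth_default // mul0r.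
    rewrite [RHS](big_ord_widen (maxn (size g) j.+1) (fun i => G`_(j - i) * g`_i)) ?leq_maxr //.
    rewrite [RHS]big_mkcond; apply: eq_bigr => i _.
    by rewrite ltnS /h bE; case: ifP; rewrite ?mulr0 // mulrC.
  rewrite qN ?mulr0; last by lia.
  apply: big1 => i _; rewrite /b.
  by have -> : N%:Z - 1 - (n + i%:Z) = Negz `|(n + i%:Z - N%:Z)%R|%N by [lia]; rewrite mulr0.
pose u n : R[i] := k%:~R * a n - (2 * pi)%:C * (b n)%:~R.
have bv : vanishing_seq (fun n => (2 * pi : R)%:C * (b n)%:~R).
  move=> e e0; exists (N + (size G).+1)%N => n nN; rewrite (_ : b n = 0).
    by rewrite mulr0 /cnorm normr0.
  rewrite /b; case nE : (N%:Z - 1 - n) => [j|//].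
  by rewrite nth_default //; move: nN; move: (size G) => m; lia.
have uv : vanishing_seq u.
  have h := vanishing_seqD (vanishing_seqZ k%:~R av) (vanishing_seqZ (-1) bv).
  by move=> e /h[N' hN]; exists N' => n /hN; rewrite mulN1r.
have u0 : forall n, u n = 0.
  apply: (vanishing_recurrence (toC_neq0 R g0) uv) => n.
  have -> : seq_act (toC g) u n = k%:~R * seq_act (toC g) a n -
      (2 * pi)%:C * (\sum_(i < size g) g`_i * b (n + i%:Z))%:~R.
    rewrite !(@seq_actE _ (size g)) ?size_poly // rmorph_sum /= !mulr_sumr -sumrB.
    apply: eq_bigr => i _; rewrite coef_map /u intrM /=; ring.
  rewrite bact aq rmorphM /= rmorph_int intrM; ring.
have zk : z *~ k = 0.
  apply: (@homoclinic_in_finite_eq0 _ alpha hausX _ _ (orbit_kernel_finite irr cs cn1)); last exact: homoclinic_Mz.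
  have Kz n : c (aut_iter alpha n (z *~ k)) = 1.
    rewrite aut_iterMz; have [-> _] := is_angleMz cs k (angleP cs (aut_iter alpha n z)).
    have -> : ang (aut_iter alpha n z) * k%:~R = 2 * pi * (b n)%:~R.
      have /eqP := u0 n; rewrite subr_eq0 => /eqP e.
      apply: (@complexI R); rewrite !rmorphM /= !rmorph_int -/(a n) mulrC e.
      by rewrite rmorphM.
    by rewrite -[X in cos X]add0r cosD2piz cos0.
  move=> n m; rewrite /= (_ : aut_iter alpha m _ = aut_iter alpha (m + n) (z *~ k)) //.
  elim/int_ind_succ_pred: m => [|m IH|m IH]; first by rewrite add0r.
    by rewrite addrAC !aut_iterS IH.
  by rewrite addrAC !aut_iterP IH.
exact: homoclinic_torsion_eq0 zk.
Qed.

End Homoclinic.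

(** * Constancy of equivariant maps *)

(** A trivial group has no nonzero [z]; otherwise a character exists, and the roots
    of an annihilator of least degree decide between the two cases. *)
Lemma no_homoclinic (R : realType) (X : topologicalZmodType) (alpha : topAut X)
    (mu : probability (borel X) R) :
  hausdorff_space X -> compact [set: X] -> connected [set: X] -> is_haar mu ->
  irreducible_aut alpha -> ~ expansive alpha ->
  forall z, homoclinic alpha z -> z = 0.
Proof.
move=> hausX compX connX haar_mu irr nexp z hz; apply: contrapT => /eqP z0.
have mI := haar_mean compX haar_mu.
have [c [cc c0 c1 dA cn1]] := exists_cosine compX mI hausX z0.
have [s cs] := cosine_character connX cc c0 dA c1 cn1.
pose S n := `[< exists f : {poly int}, [/\ f != 0,
  forall y, poly_act alpha f y = 0 & size f = n] >].
have exS : exists n, S n.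
  have [f f0 fz] := annihilator hausX compX connX irr mI cs cn1.
  by exists (size f); apply/asboolP; exists f.
case: (ex_minnP exS) => n /asboolP[f [f0 fz fn]] nmin.
have [[w [fw w1]]|nw] := pselect (exists w, root (map_poly (intmul (1 : R[i])) f) w /\ cnorm w = 1).
  move/eqP: z0; apply; apply: (homoclinic_eq0_of_unit_root hausX compX connX irr cs cn1 f0 fz _ fw w1 hz).
  by move=> g g0 gz; rewrite fn; apply: nmin; apply/asboolP; exists g.
apply: nexp; apply: (expansive_of_no_unit_root hausX irr cs cn1 f0 fz) => w fw.
by apply/eqP => w1; apply: nw; exists w.
Qed.

Theorem corollary4p9 (R : realType) (X : topologicalZmodType)
    (alpha : topAut X) (mu : probability (borel X) R)
    (A : countType) (P : rel A) (phi : bisequences A -> X) :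
  hausdorff_space X -> compact [set: X] -> connected [set: X] ->
  is_haar mu ->
  irreducible_aut alpha -> ergodic mu alpha -> ~ expansive alpha ->
  mixing_sft P ->
  {within sft P, continuous phi} ->
  (forall y, sft P y -> phi (shift_seq y) = alpha (phi y)) ->
  exists x0 : X, phi @` sft P = [set x0].
Proof.
move=> hausX compX connX haar_mu irr _ nexp mix phi_cont phi_equiv.
apply: (constant_on_mixing_sft phi_cont phi_equiv hausX mix).
exact: (no_homoclinic hausX compX connX haar_mu irr nexp).
Qed.
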